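(* Consider the robust single-index problem $$(P)\qquad \min_{\theta\in\mathbb{R}^d,\,z\in\{0,1\}^n}\ \sum_{i=1}^n\ell\bigl(r_i,f(\langle\phi_i,\theta\rangle)\bigr)(1-z_i)+\tfrac1d\|\theta\|_2^2+\sum_{i=1}^n\lambda_iz_i,$$ with covariates $\phi_i\in\mathbb{R}^d$, responses $r_i\in\mathbb{R}$, penalties $\lambda_i\ge0$, known link function $f:\mathbb{R}\to\mathbb{R}$ and loss function $\ell(\cdot,\cdot)$. Suppose that $f$ is monotone and that, for each $i$, the function $\ell_i:=\ell(r_i,\cdot)$ is convex, nonnegative, and satisfies $\ell_i(r_i)=0$. Suppose also that the number of covariates $d$ is fixed. (i) At most $O(n^d)$ regime patterns are consistent with the coordinate-wise optimality conditions. Consequently, a branch-and-bound scheme applied to the CORe formulation of $(P)$ (given in the context) that branches on the regime variables $z_i^-,z_i^+$ and prunes infeasible nodes explores $O(n^{d+1})$ nodes. (ii) If, in addition, the functions $t\mapsto\ell_i(f(t))$ are convex for all $i$, then $(P)$ can be solved by solving $O(n^d)$ convex optimization problems, and hence in polynomial time.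
   Context: CORe stands for Coordinate Optimality Reformulation. Under the stated assumptions on $f$ and $\ell$, the set $S_i(\lambda_i):=\{t\in\mathbb{R}:\ell_i(f(t))\le\lambda_i\}$ is a (possibly unbounded) interval; its endpoints are written $a_i\in\mathbb{R}\cup\{-\infty\}$ and $b_i\in\mathbb{R}\cup\{+\infty\}$, the interval being open at any infinite endpoint. Problem $(P)$ is first rewritten with correction variables $w_i$: minimize $\sum_i\ell_i(f(\langle\phi_i,\theta\rangle)+w_i)+\frac1d\|\theta\|_2^2+\sum_i\lambda_iz_i$ subject to $-M_iz_i\le w_i\le M_iz_i$, where $M_i\ge\sup_\theta|r_i-f(\langle\phi_i,\theta\rangle)|$ (supremum over the relevant range of $\theta$). Coordinate-wise optimality conditions: each observation $i$ is in one of three regimes: off ($z_i=0$, $w_i=0$ and $a_i\le\langle\phi_i,\theta\rangle\le b_i$), left ($z_i=1$ and $\langle\phi_i,\theta\rangle\le a_i$), or right ($z_i=1$ and $\langle\phi_i,\theta\rangle\ge b_i$). If $a_i=-\infty$ the left regime is empty, and if $b_i=+\infty$ the right regime is empty. A regime pattern assigns one of the three regimes to each observation $i=1,\dots,n$; it is consistent with the coordinate-wise optimality conditions if the conditions of the assigned regimes can hold simultaneously. CORe formulation: let $L_i\le\langle\phi_i,\theta\rangle\le U_i$ be known bounds, with which the three regimes are intersected. Minimize $$\sum_{i=1}^n\ell_i(f(t_i)+w_i)+\tfrac1d\|\theta\|_2^2+\sum_{i=1}^n\lambda_iz_i$$ over $\theta\in\mathbb{R}^d$, $w,t,t^0,t^-,t^+\in\mathbb{R}^n$,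 indicators $z$ with $0\le z_i\le1$, and $z^-,z^+\in\{0,1\}^n$, subject to, for all $i=1,\dots,n$: $t_i=\langle\phi_i,\theta\rangle$; $-M_iz_i\le w_i\le M_iz_i$; $z_i=z_i^-+z_i^+$; $t_i=t_i^0+t_i^-+t_i^+$; $a_i(1-z_i)\le t_i^0\le b_i(1-z_i)$; $L_iz_i^-\le t_i^-\le a_iz_i^-$; $b_iz_i^+\le t_i^+\le U_iz_i^+$. Here $z_i^-=1$ and $z_i^+=1$ represent the left and right regimes, and $z_i=0$ the off regime; an on-regime that is empty because its endpoint is infinite is absent, and in the off regime an infinite endpoint is superseded by the bound $L_i$ or $U_i$. In the branch-and-bound scheme, each node fixes some of the regime variables $z_i^-,z_i^+$, and branching on an unfixed one creates two children, in which it is fixed to $0$ and to $1$. A node is infeasible if its relaxation (unfixed binaries relaxed to $[0,1]$) is infeasible; an infeasible node is pruned and has no children.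
   Formalization: In (i), closed-regime pattern and node bounds assume at most K (fixed) observations have ⟨φ_i,θ⟩ in {a_i,b_i} at one θ, else 2^n patterns can occur; with ties resolved as off no bound is needed. Each S_i is nonempty. Time in (ii) is relative to a convex solver, with a_i,b_i given. *)

(* Defs.v *)
From HB Require Import structures.
From mathcomp Require Import all_boot all_order all_algebra.
From mathcomp Require Import boolp classical_sets reals ereal.
From mathcomp Require Import interval_inference convex.

Set Implicit Arguments.
Unset Strict Implicit.
Unset Printing Implicit Defensive.

Import Order.TTheory GRing.Theory Num.Theory.

Local Open Scope classical_set_scope.
Local Open Scope ring_scope.

(* The two on-regimes, and the regime variables z^-, z^+, are indexed by
   booleans: false is left (-), true is right (+). A regime is None (off),
   Some false (left) or Some true (right). *)
Notation regime := (option bool).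
Notation pattern n := {ffun 'I_n -> regime}.

Record instance (R : realType) (d n : nat) := Instance {
  covariate : 'I_n -> 'rV[R]_d;
  response : 'I_n -> R;
  penalty : 'I_n -> R;
  link : R -> R;
  loss : R -> R -> R }.

Section Problem.
Context {R : realType} {d n : nat} (P : instance R d n).
Implicit Types (i : 'I_n) (theta : 'rV[R]_d) (z : 'I_n -> bool).

Definition index i theta : R := \sum_(j < d) covariate P i 0 j * theta 0 j.
Definition lossi i : R -> R := loss P (response P i).

Definition objective theta z : R :=
  \sum_(i < n) lossi i (link P (index i theta)) * (1 - (z i)%:R)
  + d%:R^-1 * \sum_(j < d) theta 0 j ^+ 2
  + \sum_(i < n) penalty P i * (z i)%:R.

Definition optimal theta z : Prop :=
  forall theta' z', objective theta z <= objective theta' z'.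

Definition level_set i : set R := [set t | lossi i (link P t) <= penalty P i].
Definition lo i : \bar R := ereal_inf [set t%:E | t in level_set i].
Definition hi i : \bar R := ereal_sup [set t%:E | t in level_set i].

Definition monotone (f : R -> R) : Prop :=
  {homo f : x y / x <= y} \/ {homo f : x y /~ x <= y}.

(* An empty level set would have no endpoints lo < +oo and hi > -oo. *)
Definition assumptions : Prop :=
  [/\ monotone (link P), forall i, 0 <= penalty P i,
      forall i, [/\ @convex_function R R^o setT (lossi i),
                    forall y, 0 <= lossi i y & lossi i (response P i) = 0]
    & forall i, level_set i !=set0].

Definition convex_losses : Prop :=
  forall i, @convex_function R R^o setT (fun t => lossi i (link P t)).

Definition in_regime i (g : regime) (t : R) : bool :=
  match g with
  | None => (lo i <= t%:E)%E && (t%:E <= hi i)%E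
  | Some false => (t%:E <= lo i)%E
  | Some true => (hi i <= t%:E)%E
  end.

Definition on (g : regime) : bool := g != None.

Definition consistent (rho : pattern n) : Prop :=
  exists theta (z : 'I_n -> bool) (w : 'I_n -> R), forall i,
    [/\ z i = on (rho i), rho i = None -> w i = 0
      & in_regime i (rho i) (index i theta)].

(* The regimes overlap exactly at the endpoints. *)
Definition tie theta i : bool :=
  ((index i theta)%:E == lo i) || ((index i theta)%:E == hi i).

(* The pattern of theta when every tie is resolved in favour of off. *)
Definition pattern_of theta : pattern n :=
  [ffun i => if ((index i theta)%:E < lo i)%E then Some false
             else if (hi i < (index i theta)%:E)%E then Some true else None].

(* The problem of a regime pattern: (P) with z fixed to the pattern and theta
   confined to the assigned regimes. *)
Definition region (rho : pattern n) : set 'rV[R]_d :=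
  [set theta | forall i, in_regime i (rho i) (index i theta)].
Definition pattern_objective (rho : pattern n) theta : R :=
  objective theta (fun i => on (rho i)).
Definition minimizer (rho : pattern n) theta : Prop :=
  region rho theta /\ forall theta', region rho theta' ->
    pattern_objective rho theta <= pattern_objective rho theta'.

Definition convex_problem (rho : pattern n) : Prop :=
  @convex_set R 'rV[R]_d (region rho) /\
  @convex_function R 'rV[R]_d (region rho) (pattern_objective rho).

End Problem.

Section BranchAndBound.
Context {R : realType} {d n : nat} (P : instance R d n) (L U M : 'I_n -> R).

(* [Theta] is the relevant range of theta. *)
Definition valid_bounds (Theta : set 'rV[R]_d) : Prop :=
  Theta !=set0 /\ forall theta, Theta theta -> forall i,
    [/\ L i <= index P i theta, index P i theta <= U i
      & `|response P i - link P (index P i theta)| <= M i].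

Record core_point := CorePoint {
  ptheta : 'rV[R]_d;
  pw : 'I_n -> R;
  pt : 'I_n -> R;
  pt_off : 'I_n -> R;
  pt_on : bool -> 'I_n -> R;
  pz : 'I_n -> R;
  pz_on : bool -> 'I_n -> R }.

Definition off_lo i : R := if lo P i is r%:E then r else L i.
Definition off_hi i : R := if hi P i is r%:E then r else U i.

(* The constraints of the CORe formulation other than those on z^- and z^+
   being binary. The variables of an absent on-regime are zero. *)
Definition core_constraints (p : core_point) (i : 'I_n) : Prop :=
  [/\ pt p i = index P i (ptheta p),
      - M i * pz p i <= pw p i <= M i * pz p i,
      0 <= pz p i <= 1 /\ pz p i = pz_on p false i + pz_on p true i,
      pt p i = pt_off p i + pt_on p false i + pt_on p true i
    & [/\ off_lo i * (1 - pz p i) <= pt_off p i <= off_hi i * (1 - pz p i),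
          match lo P i with
          | a%:E => L i * pz_on p false i <= pt_on p false i
                    <= a * pz_on p false i
          | _ => pz_on p false i = 0 /\ pt_on p false i = 0
          end
        & match hi P i with
          | b%:E => b * pz_on p true i <= pt_on p true i
                    <= U i * pz_on p true i
          | _ => pz_on p true i = 0 /\ pt_on p true i = 0
          end]].

(* A node maps each regime variable to the value at which it is fixed, or to
   None when it is not fixed. *)
Definition node : Type := bool * 'I_n -> option bool.
Definition root_node : node := fun=> None.
Definition child (s : node) (v : bool * 'I_n) (b : bool) : node :=
  fun v' => if v' == v then Some b else s v'.

Definition relaxation_feasible (s : node) : Prop :=
  exists p : core_point, (forall i, core_constraints p i) /\
    forall v : bool * 'I_n,
      if s v is Some b then pz_on p v.1 v.2 = b%:R
      else 0 <= pz_on p v.1 v.2 <= 1.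

(* A tree of explored nodes. A feasible node may also be a leaf, so that every
   branching rule and every further pruning or stopping rule is allowed. *)
Inductive tree := Leaf | Branch (v : bool * 'I_n) (t0 t1 : tree).

Fixpoint explored (t : tree) : nat :=
  if t is Branch _ t0 t1 then (explored t0 + explored t1).+1 else 1.

Fixpoint bb_tree (s : node) (t : tree) : Prop :=
  if t is Branch v t0 t1 then
    [/\ relaxation_feasible s, s v = None,
        bb_tree (child s v false) t0 & bb_tree (child s v true) t1]
  else True.

End BranchAndBound.
Arguments tree : clear implicits.
Arguments root_node : clear implicits.

(* Model of computation: programs of a first-order functional language over
   real numbers and pairs (a real RAM with lists). Every elementary step has
   unit cost; real operations are exact. The syntax contains no real constant
   but 0 and 1 and does not depend on the size of the input. *)
Inductive binop := Add | Sub | Mul | Div.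

Inductive term :=
| Var (i : nat)                  (* de Bruijn index *)
| Zero
| One
| Op (o : binop) (s t : term)
| IfLe (s t u v : term)          (* if s <= t then u else v *)
| TNil
| TPair (s t : term)
| Case (s u v : term)            (* v binds both components of the pair s *)
| Let (s t : term)
| Call (f : nat) (s : term)
| Solve (s : term).              (* call of the convex solver *)

(* The f-th term is the body of the procedure f, whose argument is Var 0;
   procedure 0 is the entry point. *)
Definition program : Type := seq term.

Inductive value (R : Type) := Num (x : R) | Nil | Pair (u v : value R).
Arguments Nil {R}.

Section Semantics.
Context {R : realType} (prog : program) (solve : value R -> value R -> Prop).

Definition binop_sem (o : binop) (x y : R) : R :=
  match o with
  | Add => x + y | Sub => x - y | Mul => x * y | Div => x / y
  end.

(* [eval env t v k q]: t evaluates to v in k steps, with q solver calls. *)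
Inductive eval : seq (value R) -> term -> value R -> nat -> nat -> Prop :=
| EVar env i v : onth env i = Some v -> eval env (Var i) v 1 0
| EZero env : eval env Zero (Num 0) 1 0
| EOne env : eval env One (Num 1) 1 0
| EOp env o s t x y k1 q1 k2 q2 :
    eval env s (Num x) k1 q1 -> eval env t (Num y) k2 q2 ->
    eval env (Op o s t) (Num (binop_sem o x y)) (k1 + k2).+1 (q1 + q2)
| EIfLe env s t u v x y w k1 q1 k2 q2 k3 q3 :
    eval env s (Num x) k1 q1 -> eval env t (Num y) k2 q2 ->
    eval env (if x <= y then u else v) w k3 q3 ->
    eval env (IfLe s t u v) w (k1 + k2 + k3).+1 (q1 + q2 + q3)
| ENil env : eval env TNil Nil 1 0
| EPair env s t v w k1 q1 k2 q2 :
    eval env s v k1 q1 -> eval env t w k2 q2 ->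
    eval env (TPair s t) (Pair v w) (k1 + k2).+1 (q1 + q2)
| ECaseNil env s u v w k1 q1 k2 q2 :
    eval env s Nil k1 q1 -> eval env u w k2 q2 ->
    eval env (Case s u v) w (k1 + k2).+1 (q1 + q2)
| ECasePair env s u v x y w k1 q1 k2 q2 :
    eval env s (Pair x y) k1 q1 -> eval [:: x, y & env] v w k2 q2 ->
    eval env (Case s u v) w (k1 + k2).+1 (q1 + q2)
| ELet env s t v w k1 q1 k2 q2 :
    eval env s v k1 q1 -> eval (v :: env) t w k2 q2 ->
    eval env (Let s t) w (k1 + k2).+1 (q1 + q2)
| ECall env f body s v w k1 q1 k2 q2 :
    onth prog f = Some body ->
    eval env s v k1 q1 -> eval [:: v] body w k2 q2 ->
    eval env (Call f s) w (k1 + k2).+1 (q1 + q2)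
| ESolve env s v w k q :
    eval env s v k q -> solve v w -> eval env (Solve s) w k.+1 q.+1.

End Semantics.

Section Encoding.
Context {R : realType} {d n : nat} (P : instance R d n).

Definition enc_seq (s : seq (value R)) : value R := foldr (@Pair R) Nil s.
Definition enc_vec (x : 'rV[R]_d) : value R :=
  enc_seq [seq Num (x 0 j) | j <- enum 'I_d].
Definition enc_endpoint (x : \bar R) : value R :=
  if x is r%:E then enc_seq [:: Num r] else Nil.
Definition enc_pattern (rho : pattern n) : value R :=
  enc_seq [seq Num match rho i with
                   | None => 0 | Some false => -1 | Some true => 1
                   end | i <- enum 'I_n].

Definition enc_input : value R :=
  enc_seq [seq enc_seq [:: enc_vec (covariate P i); enc_endpoint (lo P i);
                           enc_endpoint (hi P i); Num (penalty P i)]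
          | i <- enum 'I_n].
Definition enc_output (theta : 'rV[R]_d) (z : 'I_n -> bool) : value R :=
  Pair (enc_vec theta) (enc_seq [seq Num (z i)%:R | i <- enum 'I_n]).

(* A solver returns a minimizer and the minimum of the problem of a pattern
   whenever they exist. *)
Definition is_solver (slv : pattern n -> option ('rV[R]_d * R)) : Prop :=
  forall rho,
    if slv rho is Some (theta, m) then
      minimizer P rho theta /\ m = pattern_objective P rho theta
    else ~ exists theta, minimizer P rho theta.

Definition solver_call (slv : pattern n -> option ('rV[R]_d * R))
    (v w : value R) : Prop :=
  exists2 rho, v = enc_pattern rho &
    w = if slv rho is Some (theta, m) then Pair (enc_vec theta) (Num m)
        else Nil.

(* Running [prog] on P yields theta and z in k steps, q of them solver calls. *)
Definition runs (prog : program) (slv : pattern n -> option ('rV[R]_d * R))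
    (theta : 'rV[R]_d) (z : 'I_n -> bool) (k q : nat) : Prop :=
  eval prog (solver_call slv) [:: enc_input] (Call 0 (Var 0))
       (enc_output theta z) k q.

End Encoding.

(* Main.v *)
Require Import Defs.
From HB Require Import structures.
From mathcomp Require Import all_boot all_order all_algebra.
From mathcomp Require Import boolp classical_sets reals ereal.
From mathcomp Require Import interval_inference convex.
From mathcomp Require Import topology normedtype derive.
From mathcomp Require Import ring lra zify.

Set Implicit Arguments.
Unset Strict Implicit.
Unset Printing Implicit Defensive.

Import Order.TTheory GRing.Theory Num.Theory.
Import numFieldNormedType.Exports.

Local Open Scope ring_scope.

(** The regime of observation [i] at [theta] is determined by the signs of the
    two differences of [index P i theta] with [lo P i] and with [hi P i]. These
    are [2 * n] affine functions of [theta], so everything comes down to listing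
    a set of O(n^d) sign vectors that contains every sign vector realized by some
    [theta], in all positions of the hyperplanes, degenerate ones included.

    The list comes from eliminating one coordinate at a time. Move the point
    [theta] along the first coordinate axis to the nearest hyperplane [p] that
    crosses the line of motion. No other hyperplane is strictly crossed on the
    way, so the signs at [theta] are the signs at the new point, except that a
    function which vanishes there takes the sign of its slope times the direction
    [s] in which [theta] lies ([nearest_breakpoint]). On [p] the first coordinate
    is an affine function of the others, so the new point lives in dimension
    [d - 1]. There are [2 * n] choices of [p] and three of [s], hence at most
    [6 * n] branches for each coordinate and [(6 * n) ^ d] sign vectors in all
    ([size_final_states], [final_states_cover]). A sign vector fixes [pattern_of];
    it fixes a consistent pattern except at the ties, where there are at most
    three choices each ([card_consistent]).

    In the branch-and-bound tree the relaxation of a node is feasible only if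
    some consistent pattern agrees with its fixed variables ([feasible_matching]):
    an unfixed variable merely takes [index P i theta] to the convex hull of the
    regimes that are still allowed. The patterns that agree with a node are split
    between its two children, so a level of the tree has no more branching nodes
    than there are consistent patterns, and there are [2 * n] levels
    ([explored_bound]).

    For convex losses every pattern with a nonempty region has a minimizer, by
    coercivity and compactness ([minimizer_exists]). The best value of [(P)] at a
    given [theta] is that of the pattern of [theta], because
    [lossi P i (link P t) <= penalty P i] holds exactly between the two endpoints
    ([pattern_objective_le]). So the best answer of the solver over a list of
    patterns that contains all [pattern_of P theta] is optimal. The program
    [core_program] runs the elimination above, calls the solver on each of the
    [(6 * n) ^ d] patterns obtained, and keeps the best answer
    ([core_program_correct]). *)

(** * Lexicographic signs and the nearest breakpoint *)

Section Lexicographic.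
Context {R : realType}.
Implicit Types (c : seq R) (s r : R).

Fixpoint dot c (x : seq R) : R :=
  match c, x with a :: c', y :: x' => a * y + dot c' x' | _, _ => 0 end.

Fixpoint subscale r (us vs : seq R) : seq R :=
  match us, vs with
  | u :: us', v :: vs' => (u - r * v) :: subscale r us' vs'
  | _, _ => [::]
  end.

Lemma size_subscale r us vs :
  size us = size vs -> size (subscale r us vs) = size us.
Proof. by elim: us vs => [|u us IH] [|v vs] //= [/IH ->]. Qed.

Lemma dot_subscale r us vs x : size us = size vs ->
  dot (subscale r us vs) x = dot us x - r * dot vs x.
Proof.
elim: us vs x => [|u us IH] [|v vs] [|y x] //=; rewrite ?mulr0 ?subr0 //.
by move=> [/IH ->]; ring.
Qed.

(** The sign of [l`_0 + l`_1 * e + l`_2 * e ^+ 2 + ...] for an infinitesimal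
    [e > 0]: the symbolic form of a point that was displaced slightly, several
    times in succession. It is a fold with comparisons to 0 because the program
    computes it in this way. *)
Definition lexsg (l : seq R) : R :=
  foldr (fun x acc => if x <= 0 then if 0 <= x then acc else -1 else 1) 0 l.

Lemma lexsg_cons x l : lexsg (x :: l) = if x == 0 then lexsg l else Num.sg x.
Proof.
rewrite /= -/(lexsg l); case: (ltgtP x 0) => x0 //.
  by rewrite ltr0_sg.
by rewrite gtr0_sg.
Qed.

Arguments lexsg : simpl never.

Lemma lexsg1 x : lexsg [:: x] = Num.sg x.
Proof. by rewrite lexsg_cons; case: eqP => // ->; rewrite sgr0. Qed.

Lemma lexsg_refine u v y l : lexsg [:: u; v] = Num.sg y ->
  lexsg [:: u, v & l] = lexsg (y :: l).
Proof.
rewrite !lexsg_cons; case: (eqVneq u 0) => u0.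
  case: (eqVneq v 0) => [_|v0] /esym/eqP; first by rewrite sgr_eq0 => ->.
  by move/eqP=> yv; rewrite -(sgr_eq0 y) yv sgr_eq0 (negPf v0).
by move=> uy; rewrite -(sgr_eq0 y) -uy sgr_eq0 (negPf u0).
Qed.

Lemma sgr_nearest (u w : R) : `|u| <= `|w| -> w != u -> Num.sg (w - u) = Num.sg w.
Proof.
move=> uw wu; case: (ltgtP w 0) => w0.
- by rewrite !ltr0_sg // subr_lt0 lt_neqAle wu; move: uw;
    rewrite (ltr0_norm w0) ler_norml opprK => /andP[].
- rewrite !gtr0_sg // subr_gt0 lt_neqAle eq_sym wu.
  by move: uw; rewrite (gtr0_norm w0) ler_norml => /andP[].
- by move: uw wu; rewrite w0 normr0 normr_le0 eq_sym => ->.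
Qed.

(** The functions [t |-> a i * t + b i] change sign at the points [- b i / a i].
    Let [- b p / a p] be one that is nearest to [y], and [s] the sign of [y]
    minus it. Between it and [y] no function changes sign, so each one has at [y]
    its sign at [- b p / a p], or, if it vanishes there, the sign of its slope
    times [s]. Both cases, and that of constant functions, are read off the list
    [:: value at the breakpoint; s * slope]. If all functions are constant then
    [a i / a p = 0] for any [p] because division by 0 gives 0. *)
Lemma nearest_breakpoint (I : finType) (i0 : I) (a b : I -> R) y :
  exists p s, s \in [:: 0; 1; -1] /\
    forall i, lexsg [:: b i - a i / a p * b p; s * a i] = Num.sg (a i * y + b i).
Proof.
case: (pickP (fun p => a p != 0)) => [p0 ap0|a0]; last first.
  exists i0, 0; split=> [|i]; first by rewrite inE eqxx.
  have /eqP -> := negbFE (a0 i).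
  rewrite !(mul0r, mulr0) add0r subr0 lexsg_cons lexsg1 sgr0.
  by case: eqP => // ->; rewrite sgr0.
case: (@arg_minP _ _ I p0 (fun p => a p != 0) (fun p => `|y + b p / a p| : R) ap0) => p ap pmin.
move: (ap : a p != 0) pmin => {}ap pmin; exists p, (Num.sg (y + b p / a p)); split.
  by rewrite !inE; case: sgrP => _; rewrite eqxx ?orbT.
move=> i; case: (eqVneq (a i) 0) => [->|ai].
  rewrite !(mul0r, mulr0) add0r subr0 lexsg_cons lexsg1 sgr0.
  by case: eqP => // ->; rewrite sgr0.
set u := y + b p / a p; set w := y + b i / a i.
have -> : b i - a i / a p * b p = a i * (w - u).
  by rewrite /w /u; field; rewrite ai ap.
have -> : a i * y + b i = a i * w by rewrite /w; field; rewrite ai.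
rewrite lexsg_cons mulf_eq0 (negPf ai) orFb subr_eq0.
case: (eqVneq w u) => [->|wu]; first by rewrite lexsg1 !sgrM sgr_id mulrC.
by rewrite !sgrM sgr_nearest //; apply: pmin.
Qed.

End Lexicographic.
Arguments lexsg : simpl never.

(** * Elimination of one coordinate at a time *)

Section Elimination.
Context {R : realType}.

(** An affine function in the middle of the elimination: first the coefficients
    of the remaining coordinates followed by the constant term, then the signed
    slopes along the eliminated coordinates, the latest first. *)
Definition form : Type := (seq R * seq R)%type.

(** Solving [p = 0] for the first coordinate and substituting the result in [g];
    the slope of [g] joins the history with the sign [s] of the displacement.
    When [p] does not depend on that coordinate, the quotient is 0 by convention
    and this restricts [g] to the hyperplane where the coordinate vanishes. *)
Definition eliminate (s : R) (p g : form) : form :=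
  (subscale (head 0 g.1 / head 0 p.1) (behead g.1) (behead p.1),
   s * head 0 g.1 :: g.2).

(** The sign of [g] at the point [x]; the coordinate 1 multiplies the constant
    term. *)
Definition form_sign (x : seq R) (g : form) : R :=
  lexsg (dot g.1 (rcons x 1) :: g.2).

Definition const_sign (g : form) : R := lexsg (head 0 g.1 :: g.2).

Context {n : nat}.

(** [(i, false)] is the left endpoint of observation [i], [(i, true)] the right
    one. *)
Definition state : Type := {ffun 'I_n * bool -> form}.
Implicit Types (st : state) (L : seq state).

(** [k] coordinates remain and [h] have been eliminated. *)
Definition well_formed k h st : Prop :=
  forall v, size (st v).1 = k.+1 /\ size (st v).2 = h.

Definition eliminate_state s p st : state := [ffun v => eliminate s p (st v)].

(** [pivots], [expand] and [expand_all] list their results in the order in which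
    the program produces them. *)
Definition pivots st : seq form :=
  foldr (fun i acc => [:: st (i, false), st (i, true) & acc]) [::] (enum 'I_n).

Definition expand st (rest : seq state) : seq state :=
  foldr (fun p acc => [:: eliminate_state 0 p st, eliminate_state 1 p st,
                          eliminate_state (-1) p st & acc])
        rest (pivots st).

Definition expand_all L : seq state := foldr expand [::] L.

Definition states_after k L : seq state := iter k expand_all L.

Lemma mem_pivots st v : st v \in pivots st.
Proof.
case: v => i b; rewrite /pivots; have: i \in enum 'I_n by rewrite mem_enum.
elim: (enum 'I_n) => //= j l IH; rewrite !inE => /orP[/eqP <-|/IH ->].
  by case: b {IH}; rewrite eqxx ?orbT.
by rewrite !orbT.
Qed.

Lemma pivotsP st p : p \in pivots st -> exists v, p = st v.
Proof.
rewrite /pivots; elim: (enum 'I_n) => //= i l IH; rewrite !inE.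
by case/or3P=> [/eqP ->|/eqP ->|/IH //]; [exists (i, false)|exists (i, true)].
Qed.

Lemma size_pivots st : size (pivots st) = (2 * n)%N.
Proof.
rewrite -[in RHS](size_enum_ord n) /pivots.
by elim: (enum 'I_n) => //= i l ->; rewrite mulnS.
Qed.

Lemma expandP st rest st' : reflect
  ((exists p s, [/\ p \in pivots st, s \in [:: 0; 1; -1]
                  & st' = eliminate_state s p st]) \/ st' \in rest)
  (st' \in expand st rest).
Proof.
rewrite /expand; elim: (pivots st) => /= [|p l IH].
  by apply: (iffP idP); [right|case=> // -[p [s []]]].
rewrite !inE; apply: (iffP or4P).
  case=> [/eqP ->|/eqP ->|/eqP ->|/IH].
  - by left; exists p, 0; rewrite !inE !eqxx.
  - by left; exists p, 1; rewrite !inE !eqxx orbT.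
  - by left; exists p, (-1); rewrite !inE !eqxx !orbT.
  case=> [[q [s [ql sl ->]]]|]; last by right.
  by left; exists q, s; rewrite inE ql orbT.
case=> [[q [s [ql sl def]]]|st'l]; last by constructor 4; apply/IH; right.
move: ql; rewrite inE => /orP[/eqP qp|ql].
  rewrite def qp; move: sl; rewrite !inE.
  by case/or3P=> /eqP ->; [constructor 1|constructor 2|constructor 3].
by constructor 4; apply/IH; left; exists q, s.
Qed.

Lemma size_expand st rest : size (expand st rest) = (6 * n + size rest)%N.
Proof.
have -> : (6 * n = 3 * size (pivots st))%N by rewrite size_pivots; lia.
by rewrite /expand; elim: (pivots st) => //= p l ->; lia.
Qed.

Lemma size_states_after k L :
  size (states_after k L) = ((6 * n) ^ k * size L)%N.
Proof.
elim: k => [|k IH] /=; first by rewrite mul1n.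
rewrite expnS -mulnA -IH -/(states_after k L).
by elim: (states_after k L) => /= [|st l IHl]; rewrite ?muln0 // size_expand IHl; lia.
Qed.

Lemma expand_allP L st : reflect
  (exists2 st0, st0 \in L & exists p s,
     [/\ p \in pivots st0, s \in [:: 0; 1; -1] & st = eliminate_state s p st0])
  (st \in expand_all L).
Proof.
elim: L => [|st1 L IH] /=; first by apply: (iffP idP) => // -[].
apply: (iffP (expandP _ _ _)).
  case=> [h|/IH [st0 st0L h]]; first by exists st1; rewrite ?mem_head.
  by exists st0; rewrite // inE st0L orbT.
case=> st0; rewrite inE => /orP[/eqP -> h|st0L h]; first by left.
by right; apply/IH; exists st0.
Qed.

Lemma well_formed_eliminate k h s p st : p \in pivots st ->
  well_formed k.+1 h st -> well_formed k h.+1 (eliminate_state s p st).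
Proof.
move=> /pivotsP [v ->] wf u; rewrite ffunE /=.
by rewrite size_subscale !size_behead !(proj1 (wf _)) // (proj2 (wf _)).
Qed.

Lemma well_formed_states_after k m h L :
  (forall st, st \in L -> well_formed (k + m) h st) ->
  forall st, st \in states_after k L -> well_formed m (k + h) st.
Proof.
elim: k m => [|k IH] m wf st; first exact: wf.
rewrite /states_after iterS => /expand_allP [st0 st0L [p [s [pin _ ->]]]].
rewrite addSn; apply: well_formed_eliminate => //.
by apply: IH st0L => st1 /wf; rewrite addSnnS.
Qed.

(** One displacement: the coordinates in [x] stay as they are, so the new point
    on the hyperplane of the pivot is [x] itself in dimension [k]. *)
Lemma eliminate_cover k h y x st : (0 < n)%N -> size x = k ->
  well_formed k.+1 h st ->
  exists p s, [/\ p \in pivots st, s \in [:: 0; 1; -1] &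
    forall v, form_sign x (eliminate_state s p st v) = form_sign (y :: x) (st v)].
Proof.
move=> n_gt0 xk wf.
have [p [s [sin sP]]] := nearest_breakpoint (Ordinal n_gt0, false)
  (fun v => head 0 (st v).1) (fun v => dot (behead (st v).1) (rcons x 1)) y.
exists (st p), s; split=> // [|v]; first exact: mem_pivots.
rewrite ffunE /form_sign /= dot_subscale; last first.
  by rewrite !size_behead !(proj1 (wf _)).
rewrite (lexsg_refine _ (sP v)); congr (lexsg (_ :: _)).
by case: (wf v); case: (st v).1.
Qed.

Lemma states_after_cover k h x L st : (0 < n)%N -> size x = k ->
  well_formed k h st -> st \in L ->
  exists2 st', st' \in states_after k L &
    forall v, const_sign (st' v) = form_sign x (st v).
Proof.
move=> n_gt0; elim: k h x L st => [|k IH] h x L st.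
  move=> /size0nil -> wf stL; exists st => // v.
  rewrite /form_sign /const_sign; case: (wf v); case: (st v).1 => [|c [|]] //= _ _.
  by rewrite mulr1 addr0.
case: x => // y x [xk] wf stL.
have [p [s [pin sin ps]]] := eliminate_cover y n_gt0 xk wf.
have [|st' st'in st'P] := IH _ x (expand_all L) _ xk (well_formed_eliminate s pin wf).
  by apply/expand_allP; exists st => //; exists p, s.
by exists st'; [rewrite /states_after iterSr|move=> v; rewrite st'P].
Qed.

End Elimination.
Arguments form : clear implicits.
Arguments state : clear implicits.

(** * Sign vectors of an instance *)

Section Sides.
Context {R : realType}.

(** The sign of [t - e], where [e] is a right endpoint if [b] and a left one
    otherwise. An infinite endpoint is taken to be [+oo] on the right and [-oo] on
    the left. *)
Definition side (b : bool) (e : \bar R) (t : R) : R :=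
  if e is r%:E then Num.sg (t - r) else if b then -1 else 1.

Definition affine (r c : R) (xs : seq R) : seq R :=
  foldr (fun x acc => x * r :: acc) [:: c] xs.

Lemma size_affine r c xs : size (affine r c xs) = (size xs).+1.
Proof. by elim: xs => //= x xs ->. Qed.

Lemma dot_affine r c us xs : size us = size xs ->
  dot (affine r c us) (rcons xs 1) = r * dot us xs + c.
Proof.
elim: us xs => [|u us IH] [|x xs] //=; first by rewrite mulr0 mulr1 addrC.
by case=> /IH ->; ring.
Qed.

(** An infinite endpoint gives a nonzero constant, whose sign is never that of a
    tie. *)
Definition endpoint_form (b : bool) (e : \bar R) (us : seq R) : form R :=
  (if e is r%:E then affine 1 (- r) us
   else affine 0 (if b then -1 else 1) us, [::]).

Lemma endpoint_form_sign b e us xs : size us = size xs ->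
  form_sign xs (endpoint_form b e us) = side b e (dot us xs).
Proof.
move=> eq_size; rewrite /form_sign lexsg1 /endpoint_form /side.
case: e => [r||] /=; rewrite dot_affine // ?mul1r ?mul0r ?add0r //;
by case: b; rewrite ?sgrN sgr1.
Qed.

(** The regime with ties resolved in favour of off, from the signs [a] and [b]
    relative to the left and the right endpoint. *)
Definition regime_of (a b : R) : regime :=
  if 0 <= a then if b <= 0 then None else Some true else Some false.

Definition compatible (a b : R) (g : regime) : bool :=
  match g with
  | None => (0 <= a) && (b <= 0)
  | Some false => a <= 0
  | Some true => 0 <= b
  end.

End Sides.

Section InstanceStates.
Context {R : realType} {d n : nat} (P : instance R d n).

Definition endpoint (v : 'I_n * bool) : \bar R :=
  if v.2 then hi P v.1 else lo P v.1.

Definition coords (x : 'rV[R]_d) : seq R := [seq x 0 j | j <- enum 'I_d].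

Lemma size_coords x : size (coords x) = d.
Proof. by rewrite size_map size_enum_ord. Qed.

Lemma dot_coords i theta :
  dot (coords (covariate P i)) (coords theta) = Defs.index P i theta.
Proof.
rewrite /Defs.index -big_enum /=.
rewrite /coords; elim: (enum 'I_d) => [|j s IH] /=; first by rewrite big_nil.
by rewrite big_cons IH.
Qed.

Definition init_state : state R n :=
  [ffun v => endpoint_form v.2 (endpoint v) (coords (covariate P v.1))].

Definition final_states : seq (state R n) := states_after d [:: init_state].

Definition decode (st : state R n) : pattern n :=
  [ffun i => regime_of (const_sign (st (i, false))) (const_sign (st (i, true)))].

Definition sides theta (v : 'I_n * bool) : R :=
  side v.2 (endpoint v) (Defs.index P v.1 theta).

Lemma size_final_states : size final_states = ((6 * n) ^ d)%N.
Proof. by rewrite size_states_after muln1. Qed.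

Lemma well_formed_init : well_formed d 0 init_state.
Proof.
move=> v; rewrite ffunE /=.
by case: (endpoint v) => *; rewrite size_affine size_coords.
Qed.

Lemma well_formed_final st : st \in final_states -> well_formed 0 d st.
Proof.
have -> : well_formed 0 d st = well_formed 0 (d + 0) st by rewrite addn0.
move: st; apply: well_formed_states_after => st; rewrite inE addn0 => /eqP ->.
exact: well_formed_init.
Qed.

Lemma final_states_cover theta : (0 < n)%N ->
  exists2 st, st \in final_states &
    forall v, const_sign (st v) = sides theta v.
Proof.
move=> n_gt0.
have [st stin stP] := states_after_cover n_gt0 (size_coords theta)
  well_formed_init (mem_head init_state [::]).
exists st => // v; rewrite stP ffunE endpoint_form_sign ?size_coords //.
by rewrite dot_coords.
Qed.

Hypothesis levels : forall i, (level_set P i !=set0)%classic.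

Lemma lo_le_hi i : (lo P i <= hi P i)%E.
Proof.
have [t ti] := levels i; apply: (@le_trans _ _ t%:E).
  by apply: ereal_inf_lbound; exists t.
by apply: ereal_sup_ubound; exists t.
Qed.

(** The level sets are nonempty, so that only the infinities assumed by [side]
    occur as endpoints. *)
Lemma lo_neq_pinfty i : lo P i <> +oo%E.
Proof.
have [t ti] := levels i => loi.
have : (lo P i <= t%:E)%E by apply: ereal_inf_lbound; exists t.
by rewrite loi leye_eq.
Qed.

Lemma hi_neq_ninfty i : hi P i <> -oo%E.
Proof.
have [t ti] := levels i => hii.
have : (t%:E <= hi P i)%E by apply: ereal_sup_ubound; exists t.
by rewrite hii leeNy_eq.
Qed.

Lemma lo_le_side i theta :
  (lo P i <= (Defs.index P i theta)%:E)%E = (0 <= sides theta (i, false)).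
Proof.
rewrite /sides /side /endpoint /=; have := @lo_neq_pinfty i.
by case: (lo P i) => [r||] //= _; rewrite ?leNye ?ler01 // lee_fin sgr_ge0 subr_ge0.
Qed.

Lemma ge_lo_side i theta :
  ((Defs.index P i theta)%:E <= lo P i)%E = (sides theta (i, false) <= 0).
Proof.
rewrite /sides /side /endpoint /=; have := @lo_neq_pinfty i.
case: (lo P i) => [r||] //= _; first by rewrite lee_fin sgr_le0 subr_le0.
by rewrite leeNy_eq ler10.
Qed.

Lemma le_hi_side i theta :
  ((Defs.index P i theta)%:E <= hi P i)%E = (sides theta (i, true) <= 0).
Proof.
rewrite /sides /side /endpoint /=; have := @hi_neq_ninfty i.
case: (hi P i) => [r||] //= _; first by rewrite lee_fin sgr_le0 subr_le0.
by rewrite leey oppr_le0 ler01.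
Qed.

Lemma hi_le_side i theta :
  (hi P i <= (Defs.index P i theta)%:E)%E = (0 <= sides theta (i, true)).
Proof.
rewrite /sides /side /endpoint /=; have := @hi_neq_ninfty i.
case: (hi P i) => [r||] //= _; first by rewrite lee_fin sgr_ge0 subr_ge0.
by rewrite leye_eq oppr_ge0 ler10.
Qed.

Lemma in_regimeE i g theta : in_regime P i g (Defs.index P i theta) =
  compatible (sides theta (i, false)) (sides theta (i, true)) g.
Proof.
by case: g => [[]|] /=; rewrite ?hi_le_side ?ge_lo_side ?lo_le_side ?le_hi_side.
Qed.

Lemma pattern_ofE theta i : pattern_of P theta i =
  regime_of (sides theta (i, false)) (sides theta (i, true)).
Proof.
rewrite ffunE /regime_of -lo_le_side -le_hi_side !ltNge.
by case: (lo P i <= _)%E => //=; case: (_ <= hi P i)%E.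
Qed.

Lemma pattern_of_region theta : region P (pattern_of P theta) theta.
Proof.
move=> i; rewrite in_regimeE pattern_ofE /regime_of.
case: (leP 0 (sides theta (i, false))) => [a0|/ltW //].
by case: (leP (sides theta (i, true)) 0) => [b0|/ltW //]; rewrite /= a0.
Qed.

(** Away from the endpoints the three regimes are disjoint. The case that needs
    an argument is left against right: [lo P i <= hi P i] excludes a point that
    is strictly below the former and above the latter. *)
Lemma region_tie rho theta i :
  region P rho theta -> ~~ tie P theta i -> rho i = pattern_of P theta i.
Proof.
move=> /(_ i); rewrite /tie [(_ == lo P i)]eq_le [(_ == hi P i)]eq_le.
rewrite pattern_ofE in_regimeE ge_lo_side lo_le_side le_hi_side hi_le_side.
have : sides theta (i, false) < 0 -> sides theta (i, true) < 0.
  rewrite !ltNge -lo_le_side -hi_le_side; apply: contra.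
  exact/le_trans/lo_le_hi.
rewrite /regime_of negb_or !negb_and -!ltNge.
move: (sides _ _) (sides _ _) => a b ab.
case: (rho i) => [[]|] /=; case: (ltgtP a 0) ab; case: (ltgtP b 0) => //= ?; by move=> ? /(_ isT).
Qed.

Lemma decode_cover theta : (0 < n)%N ->
  exists2 st, st \in final_states & decode st = pattern_of P theta.
Proof.
move=> /(final_states_cover theta)[st stin stP]; exists st => //.
by apply/ffunP => i; rewrite pattern_ofE ffunE !stP.
Qed.

Lemma card_pattern_of : (0 < n)%N ->
  (#|[pred rho : pattern n | `[< exists theta, rho = pattern_of P theta >]]|
     <= (6 * n) ^ d)%N.
Proof.
move=> n_gt0; rewrite -size_final_states -(size_map decode) cardE.
apply: uniq_leq_size; first exact: enum_uniq.
move=> rho; rewrite mem_enum => /asboolP [theta ->].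
have [st stin <-] := decode_cover theta n_gt0; exact: map_f.
Qed.

Lemma card_region theta K : (#|[pred i | tie P theta i]| <= K)%N ->
  (#|[pred rho : pattern n | `[< region P rho theta >]]| <= 3 ^ K)%N.
Proof.
move=> tieK; pose F i : pred regime :=
  if tie P theta i then predT else pred1 (pattern_of P theta i).
apply: (@leq_trans #|family F|).
  apply/subset_leq_card/fintype.subsetP => rho.
  move=> /asboolP reg; apply/familyP => i.
  by rewrite /F; case: ifPn => // /(region_tie reg) ->; rewrite !inE.
rewrite card_family foldrE big_map big_enum /=.
rewrite (bigID (tie P theta)) /=.
under eq_bigr => i ti do rewrite /F ti cardT -cardE card_option card_bool.
rewrite [X in (_ * X)%N]big1 => [|i /negPf ti]; last by rewrite /F ti card1.
by rewrite prod_nat_const muln1 leq_exp2l.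
Qed.

(** The set of ties of [theta] is a function of its sign vector. So all the
    patterns compatible with one sign vector are compatible with a single point
    that realizes it, and [card_region] applies to that point. *)
Lemma card_consistent K : (0 < n)%N ->
  (forall theta, (#|[pred i | tie P theta i]| <= K)%N) ->
  (#|[pred rho : pattern n | `[< consistent P rho >]]| <= 3 ^ K * (6 * n) ^ d)%N.
Proof.
move=> n_gt0 tieK; rewrite -size_final_states.
pose A st := [set rho : pattern n | `[< exists2 theta,
  (forall v, const_sign (st v) = sides theta v) & region P rho theta >]]%SET.
have cardA st : (#|A st| <= 3 ^ K)%N.
  have [[th0 th0P]|none] :=
      pselect (exists th, forall v, const_sign (st v) = sides th v).
    apply: leq_trans (card_region (tieK th0)).
    apply/subset_leq_card/fintype.subsetP => rho.
    rewrite finset.in_set => /asboolP [th thP reg].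
    apply/asboolP => i; move: (reg i).
    by rewrite !in_regimeE -!thP !th0P.
  rewrite (_ : A st = finset.set0) ?cards0 //; apply/setP => rho.
  rewrite finset.in_set finset.in_set0.
  by apply/asboolP => -[th thP _]; apply: none; exists th.
apply: (@leq_trans (\sum_(st <- final_states) #|A st|)); last first.
  elim: (final_states) => [|st l IH]; rewrite ?big_nil ?big_cons //=.
  by rewrite mulnS leq_add.
apply: (@leq_trans #|\bigcup_(st <- final_states) A st|%SET).
  apply/subset_leq_card/fintype.subsetP => rho.
  move=> /asboolP [theta [z [w cons]]].
  have [st stin stP] := final_states_cover theta n_gt0.
  rewrite (big_rem _ stin) /= finset.in_setU finset.in_set; apply/orP; left.
  by apply/asboolP; exists theta => // i; case: (cons i).
elim: (final_states) => [|st l IH]; first by rewrite !big_nil cards0.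
rewrite !big_cons; apply: leq_trans (leq_card_setU _ _) _.
by rewrite leq_add2l.
Qed.

End InstanceStates.

(** * Branch-and-bound trees *)

Section BranchAndBoundTrees.
Context {R : realType} {d n : nat} (P : instance R d n) (L U M : 'I_n -> R).
Hypothesis levels : forall i, (level_set P i !=set0)%classic.

(** The disaggregated variables write [index P i theta] as a convex combination,
    with weights [1 - z], [z^-] and [z^+], of a point of each regime. Excluding a
    regime leaves the hull of the other two: without left it is bounded below by
    [lo P i], because [lo P i <= hi P i], and without right it is bounded above
    by [hi P i]. *)
Lemma core_regimes (p : @core_point R d n) i :
  core_constraints P L U M p i ->
  0 <= pz_on p false i <= 1 -> 0 <= pz_on p true i <= 1 ->
  let t := (Defs.index P i (ptheta p))%:E in
  [/\ pz_on p false i = 1 -> pz_on p true i = 0 /\ (t <= lo P i)%E,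
      pz_on p true i = 1 -> pz_on p false i = 0 /\ (hi P i <= t)%E,
      pz_on p false i = 0 -> (lo P i <= t)%E
    & pz_on p true i = 0 -> (t <= hi P i)%E].
Proof.
case=> <- _ [/andP[_ z1] zE] -> [toff tlo thi] /andP[l0 l1] /andP[r0 r1] t.
move: toff tlo thi; rewrite {}/t /off_lo /off_hi.
have := @lo_neq_pinfty _ _ _ _ levels i; have := @hi_neq_ninfty _ _ _ _ levels i.
have := @lo_le_hi _ _ _ _ levels i.
move: zE z1.
move: (pz p i) (pt_off p i) (pt_on p false i) (pt_on p true i) => z t0 tl tr.
move: (pz_on p false i) (pz_on p true i) l0 l1 r0 r1 => l r l0 l1 r0 r1 zE z1.
case: (lo P i) => [a||] //; case: (hi P i) => [b||] //; rewrite ?lee_fin ?leey ?leNye => + _ _.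
- rewrite -subr_ge0 => ba /andP[h1 h2] /andP[h3 h4] /andP[h5 h6].
  (* The products that make the hull bounds linear: weight times gap. *)
  have bal := mulr_ge0 l0 ba; have bar := mulr_ge0 r0 ba.
  split=> e.
  - have r_0 : r = 0 by lra.
    by split=> //; move: h1 h2 h3 h4 h5 h6; rewrite zE e r_0; lra.
  - have l_0 : l = 0 by lra.
    by split=> //; move: h1 h2 h3 h4 h5 h6; rewrite zE e l_0; lra.
  - by move: h1 h2 h3 h4 h5 h6; rewrite zE e; lra.
  - by move: h1 h2 h3 h4 h5 h6; rewrite zE e; lra.
- move=> _ /andP[h1 h2] /andP[h3 h4] [h5 h6].
  split=> // e.
  - by split=> //; move: h1 h2 h3 h4; rewrite zE e h5 h6; lra.
  - by exfalso; move: h5; rewrite e; lra.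
  - by move: h1 h2 h3 h4; rewrite zE e h5 h6; lra.
- move=> _ /andP[h1 h2] [h3 h4] /andP[h5 h6].
  split=> // e.
  - by exfalso; move: h3; rewrite e; lra.
  - by split=> //; move: h1 h2 h5 h6; rewrite zE e h3 h4; lra.
  - by move: h1 h2 h5 h6; rewrite zE e h3 h4; lra.
- move=> _ _ [h3 _] [h5 _].
  by split=> // e; exfalso; [move: h3|move: h5]; rewrite e; lra.
Qed.

(** [rho] agrees with the variables that [s] fixes: [z^b_i] is the indicator of
    the regime [Some b]. *)
Definition matches (s : @node n) (rho : pattern n) : bool :=
  [forall v, if s v is Some b then b == (rho v.2 == Some v.1) else true].

Definition matching (s : @node n) : pred (pattern n) :=
  [pred rho | `[< consistent P rho >] && matches s rho].

Definition unfixed (s : @node n) : pred (bool * 'I_n) := [pred v | s v == None].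

(** Take [theta] from a feasible point. A variable fixed to 1 prescribes the
    regime, and everywhere else the pattern of [theta] will do: by [core_regimes]
    it avoids the regimes that are excluded by a variable fixed to 0. *)
Lemma feasible_matching s :
  relaxation_feasible P L U M s -> (0 < #|matching s|)%N.
Proof.
case=> p [cons fixed]; set theta := ptheta p.
have bounds v : 0 <= pz_on p v.1 v.2 <= 1.
  by have := fixed v; case: (s v) => // -[] ->; rewrite ?ler01 ?lexx.
have fixE v b : s v = Some b -> pz_on p v.1 v.2 = b%:R.
  by move=> sv; have := fixed v; rewrite sv.
pose rho : pattern n := [ffun i =>
  if s (false, i) == Some true then Some false
  else if s (true, i) == Some true then Some true else pattern_of P theta i].
have core i := core_regimes (cons i) (bounds (false, i)) (bounds (true, i)).
apply/card_gt0P; exists rho; rewrite inE; apply/andP; split.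
  apply/asboolP; exists theta, (fun i => on (rho i)), (fun=> 0) => i; split=> //.
  have [l1 r1 _ _] := core i; rewrite ffunE.
  case: (s (false, i) =P Some true) => [/fixE/l1[]//|_].
  case: (s (true, i) =P Some true) => [/fixE/r1[]//|_].
  exact: (@pattern_of_region _ _ _ _ levels).
apply/forallP => -[b i]; case sv: (s (b, i)) => [c|] //=; rewrite ffunE /=.
have [l1 r1 l0 r0] := core i; have v1 := fixE _ _ sv.
case: (s (false, i) =P Some true) => [/fixE /= fl|nl].
  have [rt0 _] := l1 fl; case: b sv v1 => sv /=; rewrite ?fl ?rt0;
  by case: c {sv} => // /eqP; rewrite ?oner_eq0 // eq_sym oner_eq0.
case: (s (true, i) =P Some true) => [/fixE /= fr|nr].
  have [lt0 _] := r1 fr; case: b sv v1 => sv /=; rewrite ?fr ?lt0;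
  by case: c {sv} => // /eqP; rewrite ?oner_eq0 // eq_sym oner_eq0.
case: c sv v1 => [|] sv /= v1; first by case: b sv v1 => sv.
rewrite ffunE; case: b sv v1 => sv /= v1.
  have := r0 v1; rewrite leNgt => /negPf ->.
  by case: (_ < _)%E.
have := l0 v1; rewrite leNgt => /negPf ->.
by case: (_ < _)%E.
Qed.

Lemma matching_child s v : s v = None ->
  (#|matching (child s v false)| + #|matching (child s v true)| = #|matching s|)%N.
Proof.
move=> sv; rewrite -(cardID [pred rho : pattern n | rho v.2 == Some v.1] (matching s)).
have E b rho : matches (child s v b) rho = matches s rho && (b == (rho v.2 == Some v.1)).
  apply/forallP/andP => [h|[/forallP h hb] u].
    split; last by have := h v; rewrite /child eqxx.
    apply/forallP => u; have := h u; rewrite /child.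
    by case: eqP => // ->; rewrite sv.
  by rewrite /child; case: eqP => [->|_] //; apply: h.
rewrite addnC; congr (_ + _)%N; apply: eq_card => rho;
  rewrite !inE E andbA; last by rewrite eq_sym eqbF_neg andbC.
by rewrite eq_sym eqb_id.
Qed.

Lemma unfixed_child s v b : s v = None ->
  (#|unfixed s| = #|unfixed (child s v b)|.+1)%N.
Proof.
move=> sv; rewrite (cardD1 v) inE sv eqxx add1n; congr _.+1.
by apply: eq_card => u; rewrite !inE /child; case: eqP.
Qed.

(** A branching node has a matching pattern, and its children share its matching
    patterns between them with one unfixed variable less. Hence there are at most
    [#|unfixed s| * #|matching s|] branching nodes below [s], and a binary tree
    has one leaf more than branching nodes. *)
Lemma explored_bound s (t : tree n) : bb_tree P L U M s t ->
  (explored t <= (#|unfixed s| * #|matching s|).*2.+1)%N.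
Proof.
elim: t s => [|v t0 IH0 t1 IH1] s //= [feas sv /IH0 b0 /IH1 b1].
have := feasible_matching feas; have := matching_child sv.
have := unfixed_child false sv; have := unfixed_child true sv.
move: #|unfixed s| #|matching s| b0 b1 => u N b0 b1 -> [u01] NE N0.
move: b0 b1 NE; rewrite -u01.
move: #|unfixed _| #|matching (child s v false)| #|matching _| => u' N0' N1' b0 b1 NE.
nia.
Qed.

Lemma card_unfixed_root : #|unfixed (root_node n)| = (2 * n)%N.
Proof.
rewrite (eq_card (B := predT)) => [|v]; last by rewrite !inE.
by rewrite cardT -cardE card_prod card_bool card_ord.
Qed.

Lemma explored_root (t : tree n) : bb_tree P L U M (root_node n) t ->
  (explored t <=
     (2 * n * #|[pred rho : pattern n | `[< consistent P rho >]]|).*2.+1)%N.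
Proof.
move=> /explored_bound /leq_trans -> //.
rewrite card_unfixed_root ltnS leq_double leq_mul2l subset_leq_card ?orbT //.
by apply/fintype.subsetP => rho /andP[].
Qed.

End BranchAndBoundTrees.

(** * Convex functions on the line *)

Section ConvexLine.
Context {R : realType} (g : R -> R).
Hypothesis convg : @convex_function R R^o setT g.

Lemma convex_le t x y : 0 <= t <= 1 ->
  g (t * x + (1 - t) * y) <= t * g x + (1 - t) * g y.
Proof.
case/andP=> t0 t1.
exact: (convg (Itv01 t0 t1) (mem_set (I : setT x)) (mem_set (I : setT y))).
Qed.

(** The upper bound is convexity on [x, x + e]. The lower one is convexity at
    [x] as a point between [x - e] and [x + k * e], with weights [k / (1 + k)] and
    [1 / (1 + k)]. *)
Lemma convex_chord x e k : 0 <= k <= 1 ->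
  - (k * (g (x - e) - g x)) <= g (x + k * e) - g x <= k * (g (x + e) - g x).
Proof.
move=> /[dup] k01 /andP[k0 k1]; apply/andP; split; last first.
  have := convex_le (x + e) x k01.
  have -> : k * (x + e) + (1 - k) * x = x + k * e by ring.
  lra.
have k1_gt0 : 0 < 1 + k by lra.
have w01 : 0 <= k / (1 + k) <= 1.
  by rewrite divr_ge0 ?(ltW k1_gt0) //= ler_pdivrMr // mul1r lerDr.
have := convex_le (x - e) (x + k * e) w01.
have -> : k / (1 + k) * (x - e) + (1 - k / (1 + k)) * (x + k * e) = x.
  by field; lra.
move=> /(ler_wpM2l (ltW k1_gt0)).
have -> : (1 + k) * (k / (1 + k) * g (x - e) + (1 - k / (1 + k)) * g (x + k * e)) =
  k * g (x - e) + g (x + k * e) by field; lra.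
lra.
Qed.

Lemma convex_dist x h : `|h| <= 1 ->
  `|g (x + h) - g x| <= `|h| * (`|g (x + 1) - g x| + `|g (x - 1) - g x|).
Proof.
move=> h1; set a := g (x + 1) - g x; set b := g (x - 1) - g x.
have h01 : 0 <= `|h| <= 1 by rewrite normr_ge0.
have bnd u v w : - (`|h| * u) <= w <= `|h| * v -> `|w| <= `|h| * (`|v| + `|u|).
  case/andP=> lw wu; rewrite ler_norml; apply/andP; split.
    apply: le_trans lw; rewrite lerN2 ler_wpM2l // (le_trans (ler_norm u)) //.
    by rewrite lerDr.
  apply: le_trans wu _; rewrite ler_wpM2l // (le_trans (ler_norm v)) //.
  by rewrite lerDl.
case: (lerP 0 h) => h0.
  have := convex_chord x 1 h01; have -> : `|h| * 1 = h by rewrite mulr1 ger0_norm.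
  exact: bnd.
have := convex_chord x (-1) h01; rewrite opprK.
have -> : `|h| * -1 = h by rewrite ltr0_norm // mulrN1 opprK.
by move=> /bnd; rewrite [_ + `|a|]addrC.
Qed.

Lemma convex_continuous : continuous g.
Proof.
move=> x; apply/cvgrPdist_lt => e e0.
set B := `|g (x + 1) - g x| + `|g (x - 1) - g x|.
have B1 : 0 < B + 1 by rewrite ltr_wpDl // addr_ge0.
have d0 : 0 < Num.min 1 (e / (B + 1)) by rewrite lt_min ltr01 divr_gt0.
apply/nbhs_ballP; exists (Num.min 1 (e / (B + 1))) => //= y.
rewrite /ball /= lt_min distrC => /andP[y1 ye].
have -> : g y = g (x + (y - x)) by congr g; ring.
rewrite distrC; apply: le_lt_trans (convex_dist _ (ltW y1)) _.
rewrite -/B; apply: le_lt_trans (_ : `|y - x| * (B + 1) < e).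
  by rewrite ler_wpM2l // lerDl.
by rewrite -ltr_pdivlMr.
Qed.

Lemma convex_sublevel_between c u t v : u < t < v -> g u <= c -> g v <= c -> g t <= c.
Proof.
move=> /andP[ut tv] gu gv; have uv : 0 < v - u by lra.
have w01 : 0 <= (v - t) / (v - u) <= 1.
  by rewrite divr_ge0 ?(ltW uv) ?subr_ge0 ?(ltW tv) //= ler_pdivrMr // mul1r; lra.
have := convex_le u v w01.
have -> : (v - t) / (v - u) * u + (1 - (v - t) / (v - u)) * v = t by field; lra.
case/andP: w01; set w := _ / _ => w0 w1 /le_trans; apply.
have := ler_wpM2l w0 gu; have w1' : 0 <= 1 - w by lra.
have := ler_wpM2l w1' gv; lra.
Qed.

End ConvexLine.

(** * The problem of a regime pattern *)

Section ConvexProblem.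
Context {R : realType} {d n : nat} (P : instance R d n).
Hypothesis assum : assumptions P.
Hypothesis convP : convex_losses P.

Let composite i t : R := lossi P i (link P t).

Let levels i : (level_set P i !=set0)%classic.
Proof. by case: assum. Qed.

(** A sublevel set of a continuous convex function is a closed interval, so it
    contains everything between its infimum and its supremum. If the loss at [t]
    exceeded the penalty, so it would on a neighbourhood of [t], and the level set
    would have points on both sides of [t], against convexity. *)
Lemma level_set_between i t :
  (lo P i <= t%:E)%E -> (t%:E <= hi P i)%E -> composite i t <= penalty P i.
Proof.
move=> lot thi; rewrite leNgt; apply/negP => gt.
have gap : 0 < composite i t - penalty P i by rewrite subr_gt0.
have /cvgrPdist_lt /(_ _ gap) /nbhs_ballP [e /= e0 near] := convex_continuous (@convP i) (x := t).
have far u : level_set P i u -> e <= `|t - u|.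
  move=> lu; rewrite leNgt; apply/negP => tu.
  have := near u tu; rewrite ltr_norml => /andP[_]; rewrite ltrD2l ltrN2.
  by rewrite ltNge; move/negP; apply.
have [u lu ut] : exists2 u, level_set P i u & u < t.
  have : (lo P i < (t + e)%:E)%E by apply: le_lt_trans lot _; rewrite lte_fin; lra.
  move=> /ereal_inf_lt [_ [u lu <-]]; rewrite lte_fin => ute; exists u => //.
  have := far _ lu; rewrite ltNge; case: (leP t u) => // tu.
  by rewrite ler0_norm; lra.
have [v lv tv] : exists2 v, level_set P i v & t < v.
  have : ((t - e)%:E < hi P i)%E by apply: lt_le_trans thi; rewrite lte_fin; lra.
  move=> /ereal_sup_gt [_ [v lv <-]]; rewrite lte_fin => vte; exists v => //.
  have := far _ lv; rewrite ltNge; case: (leP v t) => // vt.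
  by rewrite ger0_norm; lra.
have uv : u < t < v by rewrite ut.
by have := convex_sublevel_between (@convP i) uv lu lv; rewrite leNgt gt.
Qed.

Lemma penalty_lt_outside i t :
  (t%:E < lo P i)%E || (hi P i < t%:E)%E -> penalty P i < composite i t.
Proof.
move=> out; rewrite ltNge; apply/negP => lt; move: out.
have lts : [set u%:E | u in level_set P i]%classic t%:E by exists t.
by rewrite !ltNge (ereal_inf_lbound lts) (ereal_sup_ubound lts).
Qed.

(** For fixed [theta] the best choice of each [z i] is to pay the smaller of the
    loss and the penalty. This is what the pattern of [theta] does: the loss is
    at most the penalty between the endpoints, and larger outside. *)
Lemma pattern_objective_le theta z :
  pattern_objective P (pattern_of P theta) theta <= objective P theta z.
Proof.
rewrite /pattern_objective /objective !(addrAC _ (_^-1 * _)) lerD2r.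
rewrite -!big_split ler_sum // => i _ /=.
rewrite -/(composite i _).
have [_ pen0 loss_ok _] := assum; have [_ loss0 _] := loss_ok i.
have := @pattern_of_region _ _ _ P levels theta i.
have := @penalty_lt_outside i (Defs.index P i theta).
rewrite ffunE; case: ltP => /= [_ /(_ isT)|_].
  by case: (z i); rewrite /= ?subrr ?subr0; lra.
case: ltP => /= [_ /(_ isT)|_ _].
  by case: (z i); rewrite /= ?subrr ?subr0; lra.
case/andP=> lo_le le_hi; have := level_set_between lo_le le_hi.
by case: (z i); rewrite /= ?subrr ?subr0; lra.
Qed.

Let continuous_sum m (F : 'I_m -> 'rV[R]_d -> R) :
  (forall i, continuous (F i)) -> continuous (fun x => \sum_i F i x).
Proof.
by move=> cF; apply: continuous_big => [|i _]; [exact: add_continuous|exact: cF].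
Qed.

Lemma continuous_index i : continuous (Defs.index P i).
Proof.
apply: continuous_sum => j x.
by apply: continuousM; [exact: cst_continuous|exact: coord_continuous].
Qed.

Lemma continuous_pattern_objective rho : continuous (pattern_objective P rho).
Proof.
have c1 : continuous (fun theta => \sum_i
    lossi P i (link P (Defs.index P i theta)) * (1 - (on (rho i))%:R)).
  apply: continuous_sum => i x.
  apply: (@continuousM R _ (fun theta => lossi P i (link P (Defs.index P i theta)))
    (fun=> 1 - (on (rho i))%:R)); last exact: cst_continuous.
  exact: (@continuous_comp _ _ _ (Defs.index P i) (fun t => lossi P i (link P t)) x
    (@continuous_index i x) (@convex_continuous _ _ (@convP i) _)).
have c2 : continuous (fun theta : 'rV[R]_d => d%:R^-1 * \sum_j theta 0 j ^+ 2).
  move=> x; apply: (@continuousM R _ (fun=> d%:R^-1)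
    (fun theta : 'rV[R]_d => \sum_j theta 0 j ^+ 2)); first exact: cst_continuous.
  apply: (continuous_sum (F := fun j (theta : 'rV[R]_d) => theta 0 j ^+ 2)) => j {}x.
  apply: (@continuousM R _ (fun theta : 'rV[R]_d => theta 0 j)
    (fun theta : 'rV[R]_d => theta 0 j)); exact: coord_continuous.
move=> x; apply: (continuousD (continuousD (c1 x) (c2 x))).
exact: cst_continuous.
Qed.

Let closed_ge_endpoint (e : \bar R) : closed [set t : R | (e <= t%:E)%E]%classic.
Proof.
case: e => [r||].
- by under eq_set do rewrite lee_fin; exact: closed_ge.
- by under eq_set do rewrite leye_eq; rewrite set_false; exact: closed0.
- by under eq_set do rewrite leNye; rewrite set_true; exact: closedT.
Qed.

Let closed_le_endpoint (e : \bar R) : closed [set t : R | (t%:E <= e)%E]%classic.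
Proof.
case: e => [r||].
- by under eq_set do rewrite lee_fin; exact: closed_le.
- by under eq_set do rewrite leey; rewrite set_true; exact: closedT.
- by under eq_set do rewrite leeNy_eq; rewrite set_false; exact: closed0.
Qed.

Lemma closed_region rho : closed (region P rho).
Proof.
have -> : region P rho = (\bigcap_i [set theta |
    in_regime P i (rho i) (Defs.index P i theta)])%classic.
  by apply/seteqP; split=> theta h i //; [move=> _|]; apply: h.
apply: closed_bigI => i _.
apply: (proj1 (continuous_closedP (Defs.index P i)) (@continuous_index i)
  [set t | in_regime P i (rho i) t]%classic).
case: (rho i) => [[]|]; [exact: closed_ge_endpoint|exact: closed_le_endpoint|].
rewrite (_ : [set t | _]%classic = ([set t | (lo P i <= t%:E)%E] `&` [set t | (t%:E <= hi P i)%E])%classic).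
  by apply: closedI; [exact: closed_ge_endpoint|exact: closed_le_endpoint].
by apply/seteqP; split=> t /= /andP.
Qed.

(** Losses and penalties are nonnegative, so the sum of the squares is at most
    [d] times the objective. The points of the region that are at least as good
    as [theta0] thus form a closed subset of a cube, on which the continuous
    objective has a minimum. *)
Lemma minimizer_exists rho theta0 : (0 < d)%N -> region P rho theta0 ->
  exists theta, minimizer P rho theta.
Proof.
move=> d_gt0 reg0; pose c := pattern_objective P rho theta0.
(* Each coordinate satisfies x ^+ 2 <= d * c, and |x| <= x ^+ 2 + 1. *)
pose B : R := d%:R * c + 1.
pose A := (region P rho `&` [set theta | pattern_objective P rho theta <= c])%classic.
have clA : closed A.
  apply: closedI; first exact: closed_region.
  apply: (proj1 (continuous_closedP (pattern_objective P rho))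
    (@continuous_pattern_objective rho) [set y | y <= c]%classic).
  exact: closed_le.
have cube : compact [set v : 'rV[R]_d | forall j, `[-B, B] (v ord0 j)]%classic.
  by apply: (@rV_compact _ _ (fun=> `[-B, B]%classic)) => _; exact: segment_compact.
have Acube : (A `<=` [set v : 'rV[R]_d | forall j, `[-B, B] (v ord0 j)])%classic.
  move=> theta [_ /= lec] j; rewrite /= in_itv /= -ler_norml.
  have sq : theta 0 j ^+ 2 <= d%:R * c.
    have d0 : 0 < d%:R :> R by rewrite ltr0n.
    rewrite -ler_pdivrMl // (le_trans _ lec) // /pattern_objective /objective.
    have [_ pen0 loss_ok _] := assum.
    rewrite ler_wpDr ?sumr_ge0 // => [i _|]; first by rewrite mulr_ge0.
    rewrite ler_wpDl ?sumr_ge0 // => [i _|].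
      have [_ loss0 _] := loss_ok i; rewrite mulr_ge0 //.
      by case: (on _); rewrite /= ?subrr ?subr0.
    rewrite ler_pM2l ?invr_gt0 // (bigD1 j) //= lerDl sumr_ge0 // => k _.
    exact: sqr_ge0.
  have := sqr_ge0 (`|theta 0 j| - 1); have := real_normK (num_real (theta 0 j)).
  move: sq; rewrite /B; set t := `|_|; have := normr_ge0 (theta 0 j).
  rewrite -/t; nra.
have [|theta thA thmin] := EVT_min_rV _ (subclosed_compact clA cube Acube) (continuous_subspaceT (@continuous_pattern_objective rho)).
  by exists theta0; split=> //=; rewrite lexx.
move: thA; rewrite inE => -[regt lec]; exists theta; split=> // theta' reg'.
case: (leP (pattern_objective P rho theta') c) => [le'|/ltW]; last exact: le_trans.
by apply: thmin; rewrite inE; split.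
Qed.

Lemma index_conv i (t : R) x y :
  Defs.index P i (t *: x + (1 - t) *: y) =
  t * Defs.index P i x + (1 - t) * Defs.index P i y.
Proof.
rewrite /Defs.index !mulr_sumr -big_split; apply: eq_bigr => j _ /=.
by rewrite !mxE; ring.
Qed.

Lemma in_regime_conv i g (t x y : R) : 0 <= t <= 1 ->
  in_regime P i g x -> in_regime P i g y ->
  in_regime P i g (t * x + (1 - t) * y).
Proof.
move=> /andP[t0 t1]; have t1' : 0 <= 1 - t by rewrite subr_ge0.
have ge (e : \bar R) : (e <= x%:E -> e <= y%:E -> e <= (t * x + (1 - t) * y)%:E)%E.
  move=> ex ey; apply: (@le_trans _ _ (Num.min x y)%:E).
    by case: (leP x y).
  rewrite lee_fin; have minx : Num.min x y <= x by rewrite ge_min lexx.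
  have miny : Num.min x y <= y by rewrite ge_min lexx orbT.
  have := ler_wpM2l t0 minx; have := ler_wpM2l t1' miny; lra.
have le (e : \bar R) : (x%:E <= e -> y%:E <= e -> (t * x + (1 - t) * y)%:E <= e)%E.
  move=> xe ye; apply: (@le_trans _ _ (Num.max x y)%:E); last by case: (leP x y).
  rewrite lee_fin; have maxx : x <= Num.max x y by rewrite le_max lexx.
  have maxy : y <= Num.max x y by rewrite le_max lexx orbT.
  have := ler_wpM2l t0 maxx; have := ler_wpM2l t1' maxy; lra.
case: g => [[]|] /=; [exact: ge|exact: le|].
by case/andP=> lx xh /andP[ly yh]; rewrite ge // le.
Qed.

Lemma convex_problemP rho : convex_problem P rho.
Proof.
split=> [x y t xreg yreg|t x y _ _].
  apply: mem_set => i; move: (set_mem xreg i) (set_mem yreg i).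
  have -> : Defs.index P i (conv t x y) =
    t%:num * Defs.index P i x + (1 - t%:num) * Defs.index P i y by exact: index_conv.
  by apply: in_regime_conv; rewrite ge0 le1.
have t01 : (0 : R) <= t%:num <= 1 by rewrite ge0 le1.
have [t0 t1] := andP t01.
(* The convex combinations, unfolded to weighted sums. *)
change (pattern_objective P rho (t%:num *: (x : 'rV[R]_d) + (1 - t%:num) *: (y : 'rV[R]_d)) <=
  t%:num * pattern_objective P rho x + (1 - t%:num) * pattern_objective P rho y).
rewrite /pattern_objective /objective.
set pen := \sum_(i < n) penalty P i * _.
have -> : forall a b a' b' : R, t%:num * (a + b + pen) + (1 - t%:num) * (a' + b' + pen) =
  (t%:num * a + (1 - t%:num) * a') + (t%:num * b + (1 - t%:num) * b') + pen.
  by move=> *; ring.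
rewrite lerD2r lerD //.
  rewrite !mulr_sumr -big_split ler_sum // => i _ /=.
  rewrite index_conv !mulrA -mulrDl ler_wpM2r //.
    by case: (on _); rewrite /= ?subrr ?subr0.
  exact: (convex_le (@convP i)).
rewrite !(mulrCA _ d%:R^-1) -mulrDr ler_wpM2l ?invr_ge0 //.
rewrite !mulr_sumr -big_split ler_sum // => j _ /=; rewrite !mxE.
have := sqr_ge0 ((x : 'rV[R]_d) 0 j - (y : 'rV[R]_d) 0 j).
have : (0 : R) <= t%:num * (1 - t%:num) by rewrite mulr_ge0 ?subr_ge0.
move: (_ 0 j) (_ 0 j) => a b tt ab; have := mulr_ge0 tt ab; nra.
Qed.

End ConvexProblem.

(** * Evaluation with a step bound *)

Section Evaluation.
Context {R : realType} (prog : program) (solve : value R -> value R -> Prop).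

(** The number of steps is bounded and not exact, so that the two branches of a
    comparison can be given a common cost; the number of solver calls is exact. *)
Definition ev env t v K q : Prop :=
  exists2 k, Defs.eval prog solve env t v k q & (k <= K)%N.

Definition evproc f v w K q : Prop :=
  exists2 body, onth prog f = Some body & ev [:: v] body w K q.

Arguments ev env t v (K q)%_N.
Arguments evproc f v w (K q)%_N.
Implicit Types (env : seq (value R)) (t u s : term) (v w : value R).

Lemma ev_le env t v K K' q : ev env t v K q -> (K <= K')%N -> ev env t v K' q.
Proof. by case=> k ? ? ?; exists k => //; apply: leq_trans; eassumption. Qed.

Lemma ev_weaken env t v v' K K' q q' :
  ev env t v K q -> v = v' -> (K <= K')%N -> q = q' -> ev env t v' K' q'.
Proof. by move=> h <- le <-; exact: ev_le h le. Qed.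

Lemma evproc_weaken f v w w' K K' q q' :
  evproc f v w K q -> w = w' -> (K <= K')%N -> q = q' -> evproc f v w' K' q'.
Proof. by case=> body ? h *; exists body => //; exact: ev_weaken h _ _ _. Qed.

Lemma ev_var env i v : onth env i = Some v -> ev env (Var i) v 1 0.
Proof. by move=> ?; exists 1; first exact: EVar. Qed.

Lemma ev_zero env : ev env Zero (Defs.Num 0) 1 0.
Proof. by exists 1; first exact: EZero. Qed.

Lemma ev_one env : ev env One (Defs.Num 1) 1 0.
Proof. by exists 1; first exact: EOne. Qed.

Lemma ev_nil env : ev env TNil Defs.Nil 1 0.
Proof. by exists 1; first exact: ENil. Qed.

Lemma ev_op env o s t (x y : R) K1 q1 K2 q2 :
  ev env s (Defs.Num x) K1 q1 -> ev env t (Defs.Num y) K2 q2 ->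
  ev env (Op o s t) (Defs.Num (binop_sem o x y)) (K1 + K2).+1 (q1 + q2).
Proof.
move=> [k1 e1 l1] [k2 e2 l2]; exists (k1 + k2).+1; first exact: EOp.
by rewrite ltnS leq_add.
Qed.

(** The bound adds the costs of both branches, which spares a case analysis on
    the outcome of the comparison in each procedure. *)
Lemma ev_ifle env s t u u' (x y : R) w w' K1 q1 K2 q2 K3 q3 K3' q3' :
  ev env s (Defs.Num x) K1 q1 -> ev env t (Defs.Num y) K2 q2 ->
  ev env u w K3 q3 -> ev env u' w' K3' q3' -> q3' = q3 ->
  ev env (IfLe s t u u') (if x <= y then w else w')
    (K1 + K2 + (K3 + K3')).+1 (q1 + q2 + q3).
Proof.
move=> [k1 e1 l1] [k2 e2 l2] [k3 e3 l3] [k3' e3' l3'] eq_q; subst q3'.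
exists (k1 + k2 + (if x <= y then k3 else k3')).+1.
  by apply: EIfLe; eauto; case: ifP.
rewrite ltnS !leq_add //; case: ifP => _.
  exact: leq_trans l3 (leq_addr _ _).
exact: leq_trans l3' (leq_addl _ _).
Qed.

Lemma ev_pair env s t v w K1 q1 K2 q2 :
  ev env s v K1 q1 -> ev env t w K2 q2 ->
  ev env (TPair s t) (Pair v w) (K1 + K2).+1 (q1 + q2).
Proof.
move=> [k1 e1 l1] [k2 e2 l2]; exists (k1 + k2).+1; first exact: EPair.
by rewrite ltnS leq_add.
Qed.

Lemma ev_case_nil env s t u w K1 q1 K2 q2 :
  ev env s Defs.Nil K1 q1 -> ev env t w K2 q2 ->
  ev env (Case s t u) w (K1 + K2).+1 (q1 + q2).
Proof.
move=> [k1 e1 l1] [k2 e2 l2]; exists (k1 + k2).+1; first exact: ECaseNil.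
by rewrite ltnS leq_add.
Qed.

Lemma ev_case_pair env s t u v v' w K1 q1 K2 q2 :
  ev env s (Pair v v') K1 q1 -> ev [:: v, v' & env] u w K2 q2 ->
  ev env (Case s t u) w (K1 + K2).+1 (q1 + q2).
Proof.
move=> [k1 e1 l1] [k2 e2 l2]; exists (k1 + k2).+1.
  exact: ECasePair e1 e2.
by rewrite ltnS leq_add.
Qed.

Lemma ev_let env s t v w K1 q1 K2 q2 :
  ev env s v K1 q1 -> ev (v :: env) t w K2 q2 ->
  ev env (Let s t) w (K1 + K2).+1 (q1 + q2).
Proof.
move=> [k1 e1 l1] [k2 e2 l2]; exists (k1 + k2).+1; first exact: ELet e1 e2.
by rewrite ltnS leq_add.
Qed.

Lemma ev_call env f s v w K1 q1 K2 q2 :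
  ev env s v K1 q1 -> evproc f v w K2 q2 ->
  ev env (Call f s) w (K1 + K2).+1 (q1 + q2).
Proof.
move=> [k1 e1 l1] [body fbody [k2 e2 l2]]; exists (k1 + k2).+1.
  exact: ECall fbody e1 e2.
by rewrite ltnS leq_add.
Qed.

Lemma ev_solve env s v w K q :
  ev env s v K q -> solve v w -> ev env (Solve s) w K.+1 q.+1.
Proof. by move=> [k e l] vw; exists k.+1; first exact: ESolve e vw. Qed.

(** Procedure [self] computes a right fold. Its argument is a context paired with
    a list. In [init] the context is [Var 0]; in [step] the variables are
    [Var 0] the result for the tail, [Var 1] the head, [Var 2] the tail and
    [Var 3] the context. All loops of the program but one have this form, so that
    their evaluation and cost are derived once. *)
Definition fold_proc (self : nat) (init step : term) : term :=
  Case (Var 0) TNil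
    (Case (Var 1) init (Let (Call self (TPair (Var 2) (Var 1))) step)).

Lemma evproc_fold (A : eqType) (B : Type) (encA : A -> value R)
    (encB : B -> value R) (f : A -> B -> B) b0 self init step ctx K0 K1 Q1 (l : seq A) :
  onth prog self = Some (fold_proc self init step) ->
  ev [:: ctx; Defs.Nil; Pair ctx Defs.Nil] init (encB b0) K0 0 ->
  (forall x acc xs a1 a2, x \in l ->
     ev [:: encB acc; encA x; xs; ctx; a1; a2] step (encB (f x acc)) K1 Q1) ->
  evproc self (Pair ctx (enc_seq (map encA l))) (encB (foldr f b0 l))
    (size l * (K1 + 9) + K0 + 4) (size l * Q1).
Proof.
move=> body init_ev; elim: l => [|x l IH] step_ev.
  exists (fold_proc self init step) => //.
  apply: ev_le; last exact: leqnn.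
  have K0E : (0 * (K1 + 9) + K0 + 4 = (1 + (1 + K0).+1).+1)%N by lia.
  rewrite K0E; apply: (@ev_case_pair _ _ _ _ ctx Defs.Nil _ _ 0 _ 0); first exact: ev_var.
  by apply: (@ev_case_nil _ _ _ _ _ _ 0 _ 0); first exact: ev_var.
have {}IH : evproc self (Pair ctx (enc_seq (map encA l))) (encB (foldr f b0 l))
    (size l * (K1 + 9) + K0 + 4) (size l * Q1).
  by apply: IH => y acc xs a1 a2 yl; apply: step_ev; rewrite inE yl orbT.
exists (fold_proc self init step) => //.
have -> : (size (x :: l) * Q1 = 0 + (0 + ((0 + 0 + size l * Q1) + Q1)))%N.
  by rewrite /=; lia.
eapply ev_le.
  eapply ev_case_pair; first exact: ev_var.
  eapply ev_case_pair; first exact: ev_var.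
  eapply ev_let; last by apply: step_ev; rewrite mem_head.
  eapply ev_call; last exact: IH.
  by apply: ev_pair; exact: ev_var.
rewrite /=; lia.
Qed.

Lemma evproc_map (A : eqType) (encA h : A -> value R) self step ctx K1 (l : seq A) :
  onth prog self = Some (fold_proc self TNil step) ->
  (forall x acc xs a1 a2, x \in l ->
     ev [:: enc_seq acc; encA x; xs; ctx; a1; a2] step (Pair (h x) (enc_seq acc)) K1 0) ->
  evproc self (Pair ctx (enc_seq (map encA l))) (enc_seq (map h l))
    (size l * (K1 + 9) + 5) 0.
Proof.
move=> body step_ev.
have := @evproc_fold A (seq (value R)) encA enc_seq (fun x acc => h x :: acc) [::]
  self TNil step ctx 1 K1 0 l body (ev_nil _) step_ev.
by move=> /evproc_weaken; apply; [elim: l {step_ev} => //= x l [->]|lia|lia].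
Qed.

End Evaluation.
Arguments ev {R} prog solve env t v (K q)%_N.
Arguments evproc {R} prog solve f v w (K q)%_N.
Arguments evproc_fold {R prog solve A B} encA encB f b0 self init step ctx
  (K0 K1 Q1)%_N l.
Arguments evproc_map {R prog solve A} encA h self step ctx K1%_N l.

(** Evaluates a term whose pairs to be destructed are bound to variables. What
    remains are the calls, as [evproc] goals. *)
Ltac evs := repeat first
  [ exact: ev_var | exact: ev_zero | exact: ev_one | exact: ev_nil
  | match goal with |- _ = _ :> nat => reflexivity end
  | eapply ev_op | eapply ev_ifle | eapply ev_pair | eapply ev_let | eapply ev_call
  | eapply ev_case_pair; [exact: ev_var | ] ].

(** * The program *)

(** Positions of the procedures in [core_program]. *)
Notation SUBSCALE := 1%N (only parsing).
Notation ELIMINATE := 2%N (only parsing).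
Notation ELIMINATE_STATE := 3%N (only parsing).
Notation PIVOTS := 4%N (only parsing).
Notation EXPAND := 5%N (only parsing).
Notation EXPAND_ALL := 6%N (only parsing).
Notation LEXSG := 7%N (only parsing).
Notation CONST_SIGN := 8%N (only parsing).
Notation DECODE := 9%N (only parsing).
Notation BEST := 10%N (only parsing).
Notation FLAGS := 11%N (only parsing).
Notation AFFINE := 12%N (only parsing).
Notation ENDPOINT_FORM := 13%N (only parsing).
Notation INIT := 14%N (only parsing).

Notation V := Var (only parsing).
Definition minus_one : term := Op Defs.Sub Zero One.

(** The argument is [(r, (us, vs))]. *)
Definition subscale_body : term :=
  Case (V 0) TNil (Case (V 1) TNil (Case (V 0) TNil (Case (V 3) TNil
    (TPair (Op Defs.Sub (V 2) (Op Mul (V 6) (V 0)))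
           (Call SUBSCALE (TPair (V 6) (TPair (V 3) (V 1)))))))).

(** The argument is [(s, (p, g))], with [p] and [g] pairs of lists. *)
Definition eliminate_body : term :=
  Case (V 0) TNil (Case (V 1) TNil (Case (V 0) TNil (Case (V 0) TNil
    (Case (V 5) TNil (Case (V 0) TNil
      (TPair (Call SUBSCALE (TPair (Op Div (V 0) (V 4)) (TPair (V 1) (V 5))))
             (TPair (Op Mul (V 10) (V 0)) (V 3)))))))).

(** The context is [(s, p)]; the list holds the pairs of forms of a state. *)
Definition eliminate_state_step : term :=
  Case (V 1) TNil (Case (V 5) TNil
    (TPair (TPair (Call ELIMINATE (TPair (V 0) (TPair (V 1) (V 2))))
                  (Call ELIMINATE (TPair (V 0) (TPair (V 1) (V 3)))))
           (V 4))).

Definition pivots_step : term :=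
  Case (V 1) TNil (TPair (V 0) (TPair (V 1) (V 2))).

(** The context is [(state, states to follow)]; the list holds the pivots. *)
Definition expand_step : term :=
  let elim s := Call ELIMINATE_STATE (TPair (TPair s (V 3)) (V 0)) in
  Case (V 3) TNil
    (TPair (elim Zero) (TPair (elim One) (TPair (elim minus_one) (V 2)))).

Definition expand_all_step : term :=
  Call EXPAND (TPair (TPair (V 1) (V 0)) (Call PIVOTS (TPair TNil (V 1)))).

Definition lexsg_step : term :=
  IfLe (V 1) Zero (IfLe Zero (V 1) (V 0) minus_one) One.

Definition const_sign_body : term :=
  Case (V 0) TNil (Case (V 0) TNil (Call LEXSG (TPair TNil (TPair (V 0) (V 3))))).

Definition decode_step : term :=
  Case (V 1) TNil
    (TPair (IfLe Zero (Call CONST_SIGN (V 0))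
              (IfLe (Call CONST_SIGN (V 1)) Zero Zero One) minus_one)
           (V 2)).

(** The result of the fold is [Nil] or the best answer [(value, (theta, pattern))]
    so far; the list holds the final states. *)
Definition best_step : term :=
  Let (Call DECODE (TPair TNil (V 1)))
    (Let (Solve (V 0))
      (Case (V 0) (V 2)
        (Let (TPair (V 1) (TPair (V 0) (V 3)))
          (Case (V 5) (V 0) (IfLe (V 4) (V 0) (V 2) (V 7)))))).

(** The codes -1, 0, 1 of the regimes are squared to the indicators of on. *)
Definition flags_step : term := TPair (Op Mul (V 1) (V 1)) (V 0).

(** The context is [(r, c)]; the list holds the coordinates of a covariate. *)
Definition affine_init : term := Case (V 0) TNil (TPair (V 1) TNil).
Definition affine_step : term := Case (V 3) TNil (TPair (Op Mul (V 3) (V 0)) (V 2)).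

(** The argument is [(endpoint, (sign of an infinite endpoint, covariate))]. *)
Definition endpoint_form_body : term :=
  Case (V 0) TNil (Case (V 1) TNil
    (Case (V 2)
      (TPair (Call AFFINE (TPair (TPair Zero (V 0)) (V 1))) TNil)
      (TPair (Call AFFINE (TPair (TPair One (Op Defs.Sub Zero (V 0))) (V 3))) TNil))).

Definition init_step : term :=
  Case (V 1) TNil (Case (V 1) TNil (Case (V 1) TNil
    (TPair
      (TPair (Call ENDPOINT_FORM (TPair (V 2) (TPair One (V 4))))
             (Call ENDPOINT_FORM (TPair (V 0) (TPair minus_one (V 4)))))
      (V 6)))).

(** The [d] rounds of elimination are unrolled, since [d] is fixed. *)
Definition final_states_term (d : nat) : term :=
  iter d (fun t => Call EXPAND_ALL (TPair TNil t))
    (TPair (Call INIT (TPair TNil (V 0))) TNil).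

Definition main_body (d : nat) : term :=
  Let (final_states_term d)
    (Let (Call BEST (TPair TNil (V 0)))
      (Case (V 0) TNil (Case (V 1) TNil
        (TPair (V 0) (Call FLAGS (TPair TNil (V 1))))))).

Definition core_program (d : nat) : program :=
  [:: main_body d;
      subscale_body;
      eliminate_body;
      fold_proc ELIMINATE_STATE TNil eliminate_state_step;
      fold_proc PIVOTS TNil pivots_step;
      fold_proc EXPAND (Case (V 0) TNil (V 1)) expand_step;
      fold_proc EXPAND_ALL TNil expand_all_step;
      fold_proc LEXSG Zero lexsg_step;
      const_sign_body;
      fold_proc DECODE TNil decode_step;
      fold_proc BEST TNil best_step;
      fold_proc FLAGS TNil flags_step;
      fold_proc AFFINE affine_init affine_step;
      endpoint_form_body;
      fold_proc INIT TNil init_step].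

(** * Correctness and cost of the procedures *)

(** The constants in the bounds are rounded up generously: only the degree in [n]
    matters. *)

Section Procedures.
Context {R : realType} (d : nat) (solve : value R -> value R -> Prop).
Local Notation evp := (evproc (core_program d) solve).
Local Notation num := (@Defs.Num R).

Definition enc_nums (l : seq R) : value R := enc_seq (map num l).
Definition enc_form (g : form R) : value R := Pair (enc_nums g.1) (enc_nums g.2).

Lemma evp_subscale r us vs : size us = size vs ->
  evp SUBSCALE (Pair (num r) (Pair (enc_nums us) (enc_nums vs)))
    (enc_nums (subscale r us vs)) (40 * size us + 40) 0.
Proof.
elim: us vs => [|u us IH] [|v vs] //= => [_|[/IH {}IH]].
  exists subscale_body => //; eapply ev_weaken.
  - by evs; eapply ev_case_nil; [exact: ev_var|exact: ev_nil].
  - by [].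
  - by [].
  - by [].
exists subscale_body => //; eapply ev_weaken.
- evs; exact: IH.
- by [].
- by lia.
- by [].
Qed.

Lemma evp_eliminate s p g k : size p.1 = k.+1 -> size g.1 = k.+1 ->
  evp ELIMINATE (Pair (num s) (Pair (enc_form p) (enc_form g)))
    (enc_form (eliminate s p g)) (40 * k + 100) 0.
Proof.
case: p g => [[|a pt] ph] [[|b gt] gh] //= [pk] [gk].
exists eliminate_body => //; eapply ev_weaken.
- by evs; apply: (@evp_subscale (b / a) gt pt); rewrite pk gk.
- by [].
- by rewrite gk; lia.
- by [].
Qed.

Definition enc_row (lo hi : form R) : value R := Pair (enc_form lo) (enc_form hi).

Definition enc_state {n} (st : state R n) : value R :=
  enc_seq [seq enc_row (st (i, false)) (st (i, true)) | i <- enum 'I_n].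

Lemma evp_eliminate_state n (st : state R n) k h s p :
  size p.1 = k.+1 -> well_formed k h st ->
  evp ELIMINATE_STATE (Pair (Pair (num s) (enc_form p)) (enc_state st))
    (enc_state (eliminate_state s p st)) (n * (80 * k + 300) + 5) 0.
Proof.
move=> pk wf; rewrite {2}/enc_state; apply: evproc_weaken.
- apply: (evproc_map _ (fun i => enc_row (eliminate s p (st (i, false)))
    (eliminate s p (st (i, true)))) _ eliminate_state_step _ (80 * k + 250)) => //.
  move=> i acc xs a1 a2 _; eapply ev_weaken.
  + evs; apply: (@evp_eliminate s p _ k) => //; exact: (proj1 (wf _)).
  + by [].
  + by lia.
  + by [].
- by congr enc_seq; apply: eq_map => i; rewrite !ffunE.
- by rewrite size_enum_ord; lia.
- by [].
Qed.

Lemma evp_pivots n (st : state R n) :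
  evp PIVOTS (Pair Defs.Nil (enc_state st)) (enc_seq (map enc_form (pivots st)))
    (n * 30 + 5) 0.
Proof.
apply: evproc_weaken.
- apply: (evproc_fold _ (fun l => enc_seq (map enc_form l))
    (fun i acc => [:: st (i, false), st (i, true) & acc]) [::] _ _ pivots_step _ 1 20 0) => //.
  + exact: ev_nil.
  + move=> i acc xs a1 a2 _; eapply ev_weaken; [by evs|by []|by []|by []].
- by [].
- by rewrite size_enum_ord; lia.
- by rewrite muln0.
Qed.

Definition enc_states {n} (L : seq (state R n)) : value R := enc_seq (map enc_state L).

Lemma evp_expand n (st : state R n) rest k h : well_formed k h st ->
  evp EXPAND (Pair (Pair (enc_state st) (enc_states rest))
                   (enc_seq (map enc_form (pivots st))))
    (enc_states (expand st rest))
    (2 * n * (3 * (n * (80 * k + 300) + 5) + 100) + 20) 0.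
Proof.
move=> wf; apply: evproc_weaken.
- apply: (evproc_fold _ enc_states
    (fun p acc => [:: eliminate_state 0 p st, eliminate_state 1 p st,
                      eliminate_state (-1) p st & acc]) rest _ _ expand_step _ 10
      (3 * (n * (80 * k + 300) + 5) + 80) 0) => //.
  + by eapply ev_weaken; [by evs|by []|by []|by []].
  + move=> p acc xs a1 a2 /pivotsP[v ->]; have [sv _] := wf v; eapply ev_weaken.
    * by evs; apply: (@evp_eliminate_state _ _ k h).
    * by rewrite /= sub0r.
    * by lia.
    * by [].
- by [].
- by rewrite size_pivots; lia.
- by rewrite muln0.
Qed.

Definition cost_expand_all (n k : nat) : nat :=
  (2 * n * (3 * (n * (80 * k + 300) + 5) + 100) + n * 30 + 100)%N.

Lemma evp_expand_all n (L : seq (state R n)) k h :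
  (forall st, st \in L -> well_formed k h st) ->
  evp EXPAND_ALL (Pair Defs.Nil (enc_states L)) (enc_states (expand_all L))
    (size L * cost_expand_all n k + 5) 0.
Proof.
move=> wf; apply: evproc_weaken.
- apply: (evproc_fold _ enc_states expand [::] _ _ expand_all_step _ 1
    (2 * n * (3 * (n * (80 * k + 300) + 5) + 100) + n * 30 + 60) 0) => //.
  + exact: ev_nil.
  + move=> st acc xs a1 a2 /wf wfst; eapply ev_weaken.
    * evs; first exact: evp_pivots.
      exact: evp_expand wfst.
    * by [].
    * by lia.
    * by [].
- by [].
- by rewrite /cost_expand_all -addnA leq_add // leq_mul2l; apply/orP; right; lia.
- by rewrite muln0.
Qed.

Lemma evp_lexsg l :
  evp LEXSG (Pair Defs.Nil (enc_nums l)) (num (lexsg l)) (size l * 40 + 5) 0.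
Proof.
apply: evproc_weaken.
- apply: (evproc_fold num num
    (fun x acc => if x <= 0 then if 0 <= x then acc else -1 else 1) 0 _ _ lexsg_step _ 1 31 0) => //.
  + exact: ev_zero.
  + move=> x acc xs a1 a2 _; eapply ev_weaken; [by evs| |by []|by []].
    by rewrite /= sub0r; case: ifP => // _; case: ifP.
- by [].
- by rewrite -addnA leq_add // leq_mul.
- by rewrite muln0.
Qed.

Lemma evp_const_sign g k h : size g.1 = k.+1 -> size g.2 = h ->
  evp CONST_SIGN (enc_form g) (num (const_sign g)) (h * 40 + 100) 0.
Proof.
case: g => [[|c cs] hs] //= _ hsh; exists const_sign_body => //; eapply ev_weaken.
- evs; exact: (evp_lexsg (c :: hs)).
- by [].
- by rewrite /= hsh; lia.
- by [].
Qed.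

Lemma evp_decode n (st : state R n) k h : well_formed k h st ->
  evp DECODE (Pair Defs.Nil (enc_state st)) (enc_pattern (decode st))
    (n * (h * 80 + 300) + 5) 0.
Proof.
move=> wf; apply: evproc_weaken.
- apply: (evproc_map _ (fun i => num (match decode st i with
      | None => 0 | Some false => -1 | Some true => 1 end)) _ decode_step _ (h * 80 + 290)) => //.
  move=> i acc xs a1 a2 _; eapply ev_weaken.
  + have sg b : evp CONST_SIGN (enc_form (st (i, b))) (num (const_sign (st (i, b))))
        (h * 40 + 100) 0 by have [? ?] := wf (i, b); apply: evp_const_sign; eassumption.
    by evs; [exact: sg|exact: sg|].
  + rewrite /= sub0r ffunE /regime_of.
    by case: ifP => //; case: ifP.
  + by lia.
  + by [].
- by [].
- by rewrite size_enum_ord; lia.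
- by [].
Qed.

Lemma evp_flags n (rho : pattern n) :
  evp FLAGS (Pair Defs.Nil (enc_pattern rho))
    (enc_seq [seq num (on (rho i))%:R | i <- enum 'I_n]) (n * 30 + 5) 0.
Proof.
apply: evproc_weaken.
- apply: (evproc_map _ (fun i => num (on (rho i))%:R) _ flags_step _ 10) => //.
  move=> i acc xs a1 a2 _; eapply ev_weaken; [by evs| |by []|by []].
  by congr (Pair (num _) _); rewrite /=; case: (rho i) => [[]|]; rewrite /= ?mulrNN ?mulr1 ?mulr0.
- by [].
- by rewrite size_enum_ord; lia.
- by [].
Qed.

Lemma evp_affine r c xs :
  evp AFFINE (Pair (Pair (num r) (num c)) (enc_nums xs)) (enc_nums (affine r c xs))
    (size xs * 30 + 20) 0.
Proof.
apply: evproc_weaken.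
- apply: (evproc_fold num enc_nums (fun x acc => x * r :: acc) [:: c]
    _ _ affine_step _ 10 20 0) => //.
  + by eapply ev_weaken; [by evs|by []|by []|by []].
  + by move=> x acc ys a1 a2 _; eapply ev_weaken; [by evs|by []|by []|by []].
- by [].
- by rewrite -addnA leq_add // leq_mul.
- by rewrite muln0.
Qed.

Lemma evp_endpoint_form b e us :
  evp ENDPOINT_FORM
    (Pair (enc_endpoint e) (Pair (num (if b then -1 else 1)) (enc_nums us)))
    (enc_form (endpoint_form b e us)) (size us * 30 + 100) 0.
Proof.
exists endpoint_form_body => //; case: e => [r||]; eapply ev_weaken.
- by evs; exact: (evp_affine 1 (0 - r)).
- by rewrite /= sub0r.
- by lia.
- by [].
- evs; eapply ev_case_nil; first exact: ev_var; evs; exact: evp_affine.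
- by [].
- by lia.
- by [].
- evs; eapply ev_case_nil; first exact: ev_var; evs; exact: evp_affine.
- by [].
- by lia.
- by [].
Qed.

Lemma enc_coords (x : 'rV[R]_d) : enc_vec x = enc_nums (coords x).
Proof. by rewrite /enc_nums /coords -map_comp. Qed.

Lemma evp_init n (P : instance R d n) :
  evp INIT (Pair Defs.Nil (enc_input P)) (enc_state (init_state P))
    (n * (60 * d + 400) + 5) 0.
Proof.
rewrite /enc_input; under eq_map => i do rewrite enc_coords.
apply: evproc_weaken.
- apply: (evproc_map _ (fun i => enc_row (init_state P (i, false))
    (init_state P (i, true))) _ init_step _ (60 * d + 390)) => //.
  move=> i acc xs a1 a2 _; eapply ev_weaken.
  + evs; first exact: (@evp_endpoint_form false _ (coords (covariate P i))).
    rewrite /binop_sem sub0r.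
    exact: (@evp_endpoint_form true _ (coords (covariate P i))).
  + by rewrite /= !ffunE.
  + by rewrite !size_coords; lia.
  + by [].
- by [].
- by rewrite size_enum_ord; lia.
- by [].
Qed.

End Procedures.

(** * The search over the final states *)

Section Search.
Context {R : realType} {d n : nat} (P : instance R d n).
Variable slv : pattern n -> option ('rV[R]_d * R).
Local Notation evp := (evproc (core_program d) (solver_call slv)).
Local Notation num := (@Defs.Num R).

Definition best_result : Type := option (R * ('rV[R]_d * pattern n)).

Definition better (st : state R n) (acc : best_result) : best_result :=
  if slv (decode st) is Some (theta, m) then
    if acc is Some (m', _) then
      if m <= m' then Some (m, (theta, decode st)) else acc
    else Some (m, (theta, decode st))
  else acc.

Definition best (L : seq (state R n)) : best_result := foldr better None L.

Definition enc_best (b : best_result) : value R :=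
  if b is Some (m, (theta, rho)) then
    Pair (num m) (Pair (enc_vec theta) (enc_pattern rho))
  else Defs.Nil.

(** Each final state costs exactly one call of the solver. *)
Lemma evp_best (L : seq (state R n)) k h :
  (forall st, st \in L -> well_formed k h st) ->
  evp BEST (Pair Defs.Nil (enc_states L)) (enc_best (best L))
    (size L * (n * (h * 80 + 300) + 200) + 5) (size L).
Proof.
move=> wf; apply: evproc_weaken.
- apply: (evproc_fold _ enc_best better None _ _ best_step _ 1
    (n * (h * 80 + 300) + 150) 1) => //.
  + exact: ev_nil.
  + move=> st acc xs a1 a2 /wf wfst; rewrite /better.
    have solveP : solver_call slv (enc_pattern (decode st))
        (if slv (decode st) is Some (theta, m) then Pair (enc_vec theta) (num m)
         else Defs.Nil) by exists (decode st).
    case: (slv (decode st)) solveP => [[theta m]|] solveP.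
    * case: acc => [[m' [theta' rho']]|]; eapply ev_weaken.
      - eapply ev_let; first by evs; exact: evp_decode wfst.
        eapply ev_let; first by eapply ev_solve; [exact: ev_var|exact: solveP].
        by evs.
      - by rewrite /enc_best /=; case: ifP.
      - by lia.
      - by [].
      - eapply ev_let; first by evs; exact: evp_decode wfst.
        eapply ev_let; first by eapply ev_solve; [exact: ev_var|exact: solveP].
        by evs; eapply ev_case_nil; exact: ev_var.
      - by [].
      - by lia.
      - by [].
    * eapply ev_weaken.
      - eapply ev_let; first by evs; exact: evp_decode wfst.
        eapply ev_let; first by eapply ev_solve; [exact: ev_var|exact: solveP].
        by eapply ev_case_nil; exact: ev_var.
      - by [].
      - by lia.
      - by [].
- by [].
- by rewrite -addnA leq_add // leq_mul // -addnA leq_add.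
- by rewrite muln1.
Qed.

Lemma best_sound L m theta rho :
  best L = Some (m, (theta, rho)) -> slv rho = Some (theta, m).
Proof.
elim: L => //= st L IH; rewrite {1}/better.
case E: (slv (decode st)) => [[theta1 m1]|]; last exact: IH.
case: (best L) IH => [[m' r']|] IH; last by case=> <- <- <-.
by case: ifP => _; [case=> <- <- <-|exact: IH].
Qed.

Lemma best_complete L st theta m : st \in L -> slv (decode st) = Some (theta, m) ->
  exists2 b, best L = Some b & b.1 <= m.
Proof.
elim: L => //= st' L IH; rewrite inE => /orP[/eqP <- E|stL /(IH stL)[b -> bm]].
  rewrite /better E; case: (best L) => [[m' r']|]; last by eexists.
  by case: (leP m m') => mm'; eexists; rewrite //= ltW.
rewrite /better; case: (slv _) => [[theta1 m1]|]; last by eexists.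
case: b bm => m' r' /= m'm; case: (leP m1 m') => mm'; eexists; rewrite //=.
exact: le_trans mm' m'm.
Qed.

(** All lists of states met on the way have at most [S] elements, so each round
    is charged the cost of a round on [S] states. *)
Lemma ev_states_after env t0 (L : seq (state R n)) k m h S K0 :
  (forall st, st \in L -> well_formed (k + m) h st) ->
  (forall j, (j < k)%N -> (size (states_after j L) <= S)%N) ->
  ev (core_program d) (solver_call slv) env t0 (enc_states L) K0 0 ->
  ev (core_program d) (solver_call slv) env
    (iter k (fun t => Call EXPAND_ALL (TPair TNil t)) t0)
    (enc_states (states_after k L)) (K0 + k * (S * cost_expand_all n (k + m) + 20)) 0.
Proof.
elim: k m S => [|k IH] m S wf leS ev0; first by apply: ev_le ev0 _; rewrite addn0.
have wf' st : st \in L -> well_formed (k + m.+1) h st.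
  by move/wf; rewrite addSnnS.
have {}IH := IH m.+1 S wf' (fun j jk => leS j (ltnW jk)) ev0.
have wfk := well_formed_states_after wf'.
rewrite iterS; eapply ev_weaken.
- by evs; [exact: IH|exact: evp_expand_all wfk].
- by [].
- have leSk := leS k (ltnSn k); rewrite (addSnnS k m).
  have : (size (states_after k L) * cost_expand_all n m.+1 <=
          S * cost_expand_all n (k + m.+1))%N.
    by rewrite leq_mul // /cost_expand_all; nia.
  rewrite mulSn; lia.
- by [].
Qed.

(** The summands pay for the initial state, the [d] rounds of elimination, the
    solver loop, the conversion of the best pattern into [z], and the rest. *)
Definition cost_main (d n : nat) : nat :=
  (n * (60 * d + 400) + d * ((6 * n) ^ d * cost_expand_all n d + 20) +
   ((6 * n) ^ d * (n * (d * 80 + 300) + 200)) + n * 30 + 200)%N.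

Lemma evp_main m theta rho : (0 < n)%N ->
  best (final_states P) = Some (m, (theta, rho)) ->
  evp 0 (enc_input P) (enc_output theta (fun i => on (rho i)))
    (cost_main d n) ((6 * n) ^ d).
Proof.
move=> n_gt0 bestE; exists (main_body d) => //; eapply ev_weaken.
- eapply ev_let.
    apply: (@ev_states_after _ _ [:: init_state P] d 0 0 ((6 * n) ^ d)).
    + by move=> st; rewrite inE addn0 => /eqP ->; exact: well_formed_init.
    + by move=> j jd; rewrite size_states_after muln1 leq_pexp2l ?muln_gt0 // ltnW.
    + by eapply ev_weaken; [evs; exact: evp_init|by []|exact: leqnn|by []].
  eapply ev_let.
    eapply ev_call; first by evs.
    exact: (evp_best (@well_formed_final _ _ _ P)).
  rewrite bestE /=.
  by evs; exact: evp_flags.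
- by [].
- rewrite -/(final_states P) size_final_states addn0 /cost_main; lia.
- by rewrite -/(final_states P) size_final_states; lia.
Qed.

End Search.

(** * Polynomial bounds and the conclusion *)

Definition poly_bounded (f : nat -> nat) : Prop :=
  exists C e, forall n, (0 < n)%N -> (f n <= C * n ^ e)%N.

Lemma poly_bounded_const c : poly_bounded (fun=> c).
Proof. by exists c, 0 => n _; rewrite muln1. Qed.

Lemma poly_bounded_id : poly_bounded id.
Proof. by exists 1, 1 => n _; rewrite mul1n. Qed.

Lemma poly_bounded_add f g :
  poly_bounded f -> poly_bounded g -> poly_bounded (fun n => f n + g n)%N.
Proof.
move=> [C [e fC]] [D [e' gD]]; exists (C + D)%N, (e + e')%N => n n_gt0.
rewrite mulnDl leq_add //.
  by apply: leq_trans (fC n n_gt0) _; rewrite leq_mul2l leq_pexp2l ?leq_addr ?orbT.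
by apply: leq_trans (gD n n_gt0) _; rewrite leq_mul2l leq_pexp2l ?leq_addl ?orbT.
Qed.

Lemma poly_bounded_mul f g :
  poly_bounded f -> poly_bounded g -> poly_bounded (fun n => f n * g n)%N.
Proof.
move=> [C [e fC]] [D [e' gD]]; exists (C * D)%N, (e + e')%N => n n_gt0.
by rewrite expnD mulnACA leq_mul ?fC ?gD.
Qed.

Lemma poly_bounded_exp f k : poly_bounded f -> poly_bounded (fun n => f n ^ k)%N.
Proof.
move=> pf; elim: k => [|k IH]; first exact: poly_bounded_const.
have [C [e fC]] := poly_bounded_mul pf IH.
by exists C, e => n n_gt0; rewrite expnS fC.
Qed.

Lemma poly_bounded_cost_main d : poly_bounded (cost_main d).
Proof.
rewrite /cost_main /cost_expand_all.
by repeat first [ exact: poly_bounded_const | exact: poly_bounded_id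
  | apply: poly_bounded_add | apply: poly_bounded_mul | apply: poly_bounded_exp ].
Qed.

(** Every [theta] has its pattern among the decoded final states, and [theta]
    lies in the region of that pattern; so the solver has an answer there, which
    is at least as good as the objective at [theta] for any [z]. The best answer
    over all final states is therefore optimal. *)
Lemma core_program_correct (R : realType) d n (P : instance R d n)
    (slv : pattern n -> option ('rV[R]_d * R)) :
  (0 < d)%N -> (0 < n)%N -> assumptions P -> convex_losses P -> is_solver P slv ->
  exists theta z k,
    [/\ runs P (core_program d) slv theta z k ((6 * n) ^ d), optimal P theta z
      & (k <= (cost_main d n).+2)%N].
Proof.
move=> d_gt0 n_gt0 assum convP slvP.
have levels i : (level_set P i !=set0)%classic by case: assum.
have answered theta z : exists st theta' m, [/\ st \in final_states P,
    slv (decode st) = Some (theta', m) & m <= objective P theta z].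
  have [st stin stE] := decode_cover levels theta n_gt0.
  have := slvP (decode st); rewrite stE.
  case E: (slv _) => [[theta' m]|]; last first.
    by case; apply: minimizer_exists d_gt0 (pattern_of_region levels theta).
  move=> [[_ min'] mE]; exists st, theta', m; rewrite stE; split=> //.
  apply: le_trans (pattern_objective_le assum convP theta z); rewrite mE.
  exact/min'/pattern_of_region.
have [st0 [theta0 [m0 [st0in slv0 _]]]] := answered 0 (fun=> false).
have [[m [theta rho]] bestE _] := best_complete st0in slv0.
have [k run k_le] := ev_call (@ev_var _ (core_program d) (solver_call slv)
  [:: enc_input P] 0 _ erefl) (evp_main n_gt0 bestE).
exists theta, (fun i => on (rho i)), k; split=> // theta' z'.
have [st [theta1 [m1 [stin slv1 m1le]]]] := answered theta' z'.
have [b] := best_complete stin slv1; rewrite bestE => -[<-] /= mm1.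
have := slvP rho; rewrite (best_sound bestE) => -[_ mE].
by rewrite -/(pattern_objective P rho theta) -mE (le_trans mm1).
Qed.

Theorem proposition5 (R : realType) (d : nat) (d_gt0 : (0 < d)%N) :
  (* (i) *)
  [/\ exists C : nat, forall (n : nat) (P : instance R d n),
        (0 < n)%N -> assumptions P ->
        (#|[pred rho : pattern n |
             `[< exists theta, rho = pattern_of P theta >]]| <= C * n ^ d)%N,
      forall K : nat, exists C : nat, forall (n : nat) (P : instance R d n),
        (0 < n)%N -> assumptions P ->
        (forall theta, (#|[pred i | tie P theta i]| <= K)%N) ->
        (#|[pred rho : pattern n | `[< consistent P rho >]]| <= C * n ^ d)%N /\
        forall (L U M : 'I_n -> R) (Theta : set 'rV[R]_d),
          valid_bounds P L U M Theta ->
          forall t : tree n, bb_tree P L U M (root_node n) t ->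
          (explored t <= C * n ^ d.+1)%N
  (* (ii) *)
    & exists (prog : program) (C e : nat), forall (n : nat) (P : instance R d n),
        (0 < n)%N -> assumptions P -> convex_losses P ->
        (forall rho, convex_problem P rho) /\
        forall slv, is_solver P slv ->
        exists theta z k q,
          [/\ runs P prog slv theta z k q, optimal P theta z,
              (q <= C * n ^ d)%N & (k <= C * n ^ e)%N]].
Proof.
split=> [|K|].
- exists (6 ^ d)%N => n P n_gt0 [_ _ _ levels].
  by rewrite -expnMn; exact: card_pattern_of.
- exists (4 * (3 ^ K * 6 ^ d) + 1)%N => n P n_gt0 [_ _ _ levels] ties.
  have := card_consistent levels n_gt0 ties; rewrite expnMn mulnA.
  set N := #|_|; set c := (3 ^ K * 6 ^ d)%N => leN.
  split=> [|L U M Theta _ t /(explored_root levels)].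
    by apply: leq_trans leN _; rewrite leq_mul2r; apply/orP; right; lia.
  rewrite -/N => /leq_trans; apply; rewrite expnS mulnCA.
  have : (0 < n * n ^ d)%N by rewrite -expnS expn_gt0 n_gt0.
  have : (n * N <= n * (c * n ^ d))%N by rewrite leq_mul2l leN orbT.
  move: (n ^ d)%N => D; rewrite -mul2n; nia.
- have [C [e costC]] := poly_bounded_add (poly_bounded_cost_main d) (poly_bounded_const 2).
  exists (core_program d), (6 ^ d + C)%N, e => n P n_gt0 assum convP.
  split=> [rho|slv slvP]; first exact: convex_problemP.
  have [theta [z [k [run opt k_le]]]] :=
    core_program_correct d_gt0 n_gt0 assum convP slvP.
  exists theta, z, k, ((6 * n) ^ d)%N; split=> //.
    by rewrite expnMn leq_mul2r leq_addr orbT.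
  apply: leq_trans k_le _; rewrite -addn2; apply: leq_trans (costC n n_gt0) _.
  by rewrite leq_mul2r leq_addl orbT.
Qed.
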